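(* Let $T$ be an infinite, locally finite tree. Then every positively associated, finite-range dependent bond percolation model $\mathrm{P}$ on $T$ with marginals $p > p_c(T) = \frac{1}{\mathrm{br}(T)}$ percolates.
   Context: For a graph $G=(V,E)$, a bond percolation model is a probability measure $\mathrm{P}$ on $\{0,1\}^E$ with the product $\sigma$-algebra; for a configuration $\omega$, the edge $e$ is open if $\omega(e)=1$ and closed if $\omega(e)=0$. For vertices $u,v$, $d(u,v)$ is the graph distance; for edges, $d(e,f)=\inf\{d(u,v): u\in e, v\in f\}$, and for edge sets, $d(F_1,F_2)=\inf\{d(e,f): e\in F_1,f\in F_2\}$. An event $A$ is increasing if $\omega\in A$ and $\omega\le\omega'$ (coordinatewise) imply $\omega'\in A$. $\mathrm{P}$ is positively associated if $\mathrm{P}[A_1\cap A_2]\ge \mathrm{P}[A_1]\,\mathrm{P}[A_2]$ for all increasing events $A_1,A_2$. For an integer $k\ge 0$, $\mathrm{P}$ is $k$-independent if the edge statuses in $F_1$ are independent of the edge statuses in $F_2$ whenever $F_1,F_2\subseteq E$ are disjoint and at distance at least $k$. $\mathrm{P}$ is finite-range dependent if it is $k$-independent for some integer $k \ge 0$. $\mathrm{P}$ has marginals $p\in[0,1]$ if $\mathrm{P}[\omega(e)=1]=p$ for all $e\in E$. $\mathrm{P}$ percolates if with positive probability the random subgraph $(V,\{e\in E:\omega(e)=1\})$ contains an infinite connected component. $p_c(T)$ is the supremum of all $p$ for which Bernoulli bond percolation on $T$ (edges open independently with probability $p$) does not percolate. Branching number: fix a root $o$ of $T=(V,E)$ and orient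 edges away from $o$, $N^+(v)$ being the set of children of $v$. A flow is a function $\theta:V\to[0,\infty)$ with $\theta(v)=\sum_{w\in N^+(v)}\theta(w)$ for all $v\in V$; it is a unit flow if $\theta(o)=1$. With $U(T)$ the set of unit flows, $$\mathrm{br}(T)=\sup_{\theta\in U(T)}\ \liminf_{d(o,v)\to\infty}\theta(v)^{-1/d(o,v)}$$ (with $0^{-1/d}=+\infty$ and $1/\infty=0$); this does not depend on the root. The identity $p_c(T)=1/\mathrm{br}(T)$ is a known theorem of Lyons. *)

(* Defs.v *)
From HB Require Import structures.
From mathcomp Require Import all_boot all_order all_algebra.
From mathcomp Require Import all_classical all_reals all_analysis.

Set Implicit Arguments.
Unset Strict Implicit.
Unset Printing Implicit Defensive.

Import Order.TTheory GRing.Theory Num.Theory.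

Local Open Scope classical_set_scope.
Local Open Scope ring_scope.

Record sgraph := SGraph {
  vertex :> choiceType;
  adj : rel vertex;
  adj_sym : symmetric adj;
  adj_irr : irreflexive adj }.

Section graph.
Variable G : sgraph.

Definition edges : set (set G) :=
  [set A | exists u v : G, adj u v /\ A = [set u; v]].

Definition edge : Type := edges.

(* [walk r n u v]: an [r]-walk with [n] steps from [u] to [v]. *)
Definition walk (r : rel G) (n : nat) (u v : G) : Prop :=
  exists s : seq G, [/\ path r u s, last u s = v & size s = n].

Definition joined (r : rel G) (u v : G) : Prop := exists n, walk r n u v.

(* Only meaningful when [u] and [v] are joined; otherwise the value is 0. *)
Definition dist (u v : G) : nat :=
  get [set n | walk (@adj G) n u v /\
               forall m, walk (@adj G) m u v -> (n <= m)%N].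

(* [cycle] also holds of [:: u; v] when [u] and [v] are adjacent, hence the
   bound 2. *)
Definition acyclic : Prop :=
  forall c : seq G, uniq c -> cycle (@adj G) c -> (size c <= 2)%N.

Definition is_tree : Prop := (forall u v : G, joined (@adj G) u v) /\ acyclic.

Definition locally_finite : Prop :=
  forall v : G, finite_set [set w | adj v w].

End graph.

Section percolation.
Variable G : sgraph.

Definition coord_events (F : set (edge G)) : set (set (edge G -> bool)) :=
  [set A | exists e : edge G, exists b : bool, F e /\ A = [set w | w e = b]].

(* {0,1}^E with the product sigma-algebra. *)
Definition config := g_sigma_algebraType (coord_events [set: edge G]).

Definition open_at (e : edge G) : set config := [set w | w e].

Definition open_adj (w : config) : rel G :=
  fun u v => `[< exists2 e : edge G, val e = [set u; v] & w e >].

Definition cluster (w : config) (v : G) : set G := [set u | joined (open_adj w) v u].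

Definition percolation_event : set config :=
  [set w | exists v : G, infinite_set (cluster w v)].

Definition increasing (A : set config) : Prop :=
  forall w w' : config, A w -> (forall e, w e ==> w' e) -> A w'.

Variable R : realType.

(* The infima are taken in the extended reals, so the distance to the empty set
   of edges is [+oo]. *)
Definition edge_dist (e f : edge G) : \bar R :=
  ereal_inf [set ((dist u v)%:R)%:E | u in val e & v in val f].

Definition edge_set_dist (F1 F2 : set (edge G)) : \bar R :=
  ereal_inf [set edge_dist e f | e in F1 & f in F2].

Implicit Type P : probability config R.
Local Open Scope ereal_scope.

Definition percolates P : Prop := 0 < P percolation_event.

Definition positively_associated P : Prop :=
  forall A1 A2 : set config, measurable A1 -> measurable A2 ->
    increasing A1 -> increasing A2 -> P A1 * P A2 <= P (A1 `&` A2).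

Definition k_independent P (k : nat) : Prop :=
  forall F1 F2 : set (edge G), F1 `&` F2 = set0 ->
    k%:R%:E <= edge_set_dist F1 F2 ->
    forall A1 A2 : set config,
      <<s coord_events F1 >> A1 -> <<s coord_events F2 >> A2 ->
      P (A1 `&` A2) = P A1 * P A2.

Definition finite_range_dependent P : Prop := exists k, k_independent P k.

Definition has_marginals P (p : R) : Prop :=
  (0 <= p <= 1)%R /\ forall e, P (open_at e) = p%:E.

(* There is a unique such [P] for each p in [0,1], since the events [open_at e]
   generate the sigma-algebra. *)
Definition bernoulli_percolation P (p : R) : Prop :=
  has_marginals P p /\
  forall s : seq (edge G), uniq s ->
    P (\bigcap_(e in [set` s]) open_at e) = \prod_(e <- s) P (open_at e).

End percolation.

Definition pc (R : realType) (G : sgraph) : R :=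
  sup [set p : R | exists2 P : probability (config G) R,
         bernoulli_percolation P p & ~ percolates P].

Section branching.
Variables (R : realType) (G : sgraph) (o : G).

Definition children (v : G) : set G :=
  [set w | adj v w /\ dist o w = (dist o v).+1].

Definition flow (theta : G -> R) : Prop :=
  forall v, 0 <= theta v /\ theta v = \sum_(w \in children v) theta w.

Definition unit_flow (theta : G -> R) : Prop := flow theta /\ theta o = 1.

(* theta(v)^(-1/d(o,v)), with 0^(-1/d) = +oo (whereas [powR] would give 0). *)
Definition flow_rate (theta : G -> R) (v : G) : \bar R :=
  if theta v == 0 then +oo%E
  else (theta v `^ (- ((dist o v)%:R)^-1))%:E.

(* liminf of [f v] as d(o,v) tends to infinity. *)
Definition liminf_dist (f : G -> \bar R) : \bar R :=
  ereal_sup [set ereal_inf [set f v | v in [set v | (n <= dist o v)%N]]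
            | n in [set: nat]].

Definition br : \bar R :=
  ereal_sup [set liminf_dist (flow_rate theta) | theta in unit_flow].

End branching.

(* Main.v *)
Require Import Defs.
From HB Require Import structures.
From mathcomp Require Import all_boot all_order all_algebra.
From mathcomp Require Import all_classical all_reals all_analysis.
From mathcomp Require Import zify ring lra.

Set Implicit Arguments.
Unset Strict Implicit.
Unset Printing Implicit Defensive.

Import Order.TTheory GRing.Theory Num.Theory.

Local Open Scope classical_set_scope.
Local Open Scope ring_scope.

(** Root the tree at [o].  If [P] percolates and the path between two nested
    vertices at distance [d] is open with probability at most [q ^ d], then
    for some [u] the probability [g v] that [u] is joined to infinity through
    [v] is subadditive over the children of [v], and [g v <= C * q ^ |v|].
    Splitting a flow at each vertex proportionally to [g] keeps it below [g],
    so [br T >= 1/q].  Applied to Bernoulli percolation, this is the bound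
    [p_c >= 1 / br T].

    Conversely, let [theta] be a unit flow with [theta v <= C * l ^ - |v|] and
    [l * p > 1].  If [z] is the last common ancestor of [x] and [y], dropping
    the [k] edges below [z] on the way to [x] makes the rest of that path
    independent of the path to [y], and positive association restores them at
    the cost of a factor [p ^ k]; hence
    [P (o -> x, o -> y) <= p ^ - k * P (o -> x) * P (o -> y) / P (o -> z)].
    The second moment of [\sum_(|x| = n) theta x * 1_(o -> x) / P (o -> x)] is
    then bounded uniformly in [n] by a geometric series, so [o] is joined to
    infinity with positive probability.  This uses positive association only
    for events that finitely many edges are all open, which is immediate for
    Bernoulli percolation; the same argument therefore also gives
    [p_c <= 1 / br T]. *)

(** * Rooted trees *)

Section rooted_tree.
Variables (T : sgraph) (o : T).
Hypotheses (treeT : is_tree T) (lfT : locally_finite T).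
Local Open Scope nat_scope.

Implicit Types u v w x y z : T.

Local Notation lev v := (dist o v).

(** Connectedness provides some walk, hence one of minimal length, so [get] in [dist] picks a
    genuine value rather than its default. *)
Lemma dist_spec u v : walk (@adj T) (dist u v) u v /\
  forall m, walk (@adj T) m u v -> dist u v <= m.
Proof.
have /getPex// : exists n, walk (@adj T) n u v /\
    forall m, walk (@adj T) m u v -> n <= m.
have [n wn] := treeT.1 u v.
have ex : exists n, `[< walk (@adj T) n u v >] by exists n; apply/asboolP.
case: (ex_minnP ex) => m /asboolP wm mmin.
by exists m; split => // j wj; apply: mmin; apply/asboolP.
Qed.

Lemma lev_root : lev o = 0.
Proof.
by apply/eqP; rewrite -leqn0; apply: (dist_spec o o).2; exists [::].
Qed.

Lemma lev_eq0 v : lev v = 0 -> v = o.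
Proof.
move=> v0; have [s [_ lE]] := (dist_spec o v).1.
by rewrite v0 => /size0nil sE; rewrite -lE sE.
Qed.

Lemma lev_adj u v : adj u v -> lev v <= (lev u).+1.
Proof.
move=> uv; have [[s [ps ls ss]] _] := dist_spec o u.
apply: (dist_spec o v).2; exists (rcons s v).
by rewrite rcons_path ps ls uv last_rcons size_rcons ss.
Qed.

(** The last but one vertex of a shortest walk from [o] to [v] will do. *)
Lemma lower_neighbour v : v <> o -> exists u, adj u v /\ (lev u).+1 = lev v.
Proof.
move=> vo; have [[s [ps ls ss]] _] := dist_spec o v.
case/lastP: s ps ls ss => [|s w]; first by move=> _ /= /esym.
rewrite rcons_path last_rcons size_rcons => /andP[ps wv] wE ss; subst w.
exists (last o s); split => //.
have := lev_adj wv.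
have : lev (last o s) <= size s by apply: (dist_spec o _).2; exists s.
lia.
Qed.

(* A path between two vertices at the same level, staying at or above that
   level, is extended by the lower neighbours of its ends until these coincide,
   which closes a cycle. *)
Lemma no_arch n x y (s : seq T) :
  uniq (x :: rcons s y) -> path (@adj T) x (rcons s y) ->
  lev x = n -> lev y = n -> {in s, forall z, n <= lev z} -> False.
Proof.
elim: n x y s => [|n IH] x y s U p lx ly ls.
  by move: U; rewrite (lev_eq0 lx) (lev_eq0 ly) /= mem_rcons mem_head.
have neo z : lev z = n.+1 -> z <> o by move=> + zo; rewrite zo lev_root.
have [px [ax lpx]] := lower_neighbour (neo _ lx).
have [py [ay lpy]] := lower_neighbour (neo _ ly).
have mem_lev z : z \in x :: rcons s y -> n.+1 <= lev z.
  rewrite inE mem_rcons inE => /or3P[/eqP->|/eqP->|/ls//]; lia.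
have nx : px \notin x :: rcons s y by apply/negP => /mem_lev; lia.
have ny : py \notin x :: rcons s y by apply/negP => /mem_lev; lia.
have [pxy|pxy] := eqVneq px py.
  have := treeT.2 (px :: x :: rcons s y).
  rewrite cons_uniq nx U => /(_ isT); rewrite /= size_rcons.
  rewrite ax rcons_path p last_rcons pxy adj_sym ay /=.
  by move/(_ isT).
apply: (IH px py (x :: rcons s y)).
- rewrite cons_uniq mem_rcons inE negb_or pxy nx /=.
  rewrite -[_ && _]/(uniq (rcons (x :: rcons s y) py)) rcons_uniq ny.
  exact: U.
- by rewrite /= ax rcons_path p last_rcons adj_sym ay.
- lia.
- lia.
- by move=> z /mem_lev; lia.
Qed.

(** An edge within one level would be an arch without interior vertices, which [no_arch] forbids. *)
Lemma lev_adj_neq u v : adj u v -> lev u <> lev v.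
Proof.
move=> uv luv; apply: (@no_arch (lev u) u v [::]) => //=; last by rewrite uv.
rewrite andbT inE; apply/negP => /eqP uE.
by move: uv; rewrite uE adj_irr.
Qed.

(** Two distinct lower neighbours joined through [v] would form an arch over their common level. *)
Lemma lower_neighbour_inj v a b : adj a v -> adj b v ->
  (lev a).+1 = lev v -> (lev b).+1 = lev v -> a = b.
Proof.
move=> av bv la lb; apply/eqP/negPn/negP => ab.
apply: (@no_arch (lev a) a b [:: v]) => //=.
- rewrite !inE andbT negb_or ab /= andbT.
  by apply/andP; split; apply/negP => /eqP E; [move: la|move: lb]; rewrite E; lia.
- by rewrite av adj_sym bv.
- lia.
- by move=> z; rewrite inE => /eqP ->; lia.
Qed.

(** The default [v] makes [o] its own parent, so iterating [parent] becomes stationary at the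
    root. *)
Definition parent v : T := xget v [set u | adj u v /\ (lev u).+1 = lev v].

Lemma parentP v : v <> o -> adj (parent v) v /\ (lev (parent v)).+1 = lev v.
Proof. by move=> vo; exact: (xgetPex v (lower_neighbour vo)). Qed.

Lemma parent_root : parent o = o.
Proof. by apply: xgetPN => u [_]; rewrite lev_root. Qed.

Lemma lev_parent v : lev (parent v) = (lev v).-1.
Proof.
have [->|/eqP/parentP[_ <-]//] := eqVneq v o.
by rewrite parent_root lev_root.
Qed.

Lemma parent_unique u v : adj u v -> (lev u).+1 = lev v -> parent v = u.
Proof.
move=> uv luv; have vo : v <> o by move=> vo; move: luv; rewrite vo lev_root.
have [pv lpv] := parentP vo.
exact: lower_neighbour_inj pv uv lpv luv.
Qed.

Lemma adj_parent u v : adj u v ->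
  (parent v = u /\ lev v = (lev u).+1) \/ (parent u = v /\ lev u = (lev v).+1).
Proof.
move=> uv; have vu : adj v u by rewrite adj_sym.
have := lev_adj uv; have := lev_adj vu; have := lev_adj_neq uv.
move=> h1 h2 h3.
have [E|E] : (lev u).+1 = lev v \/ (lev v).+1 = lev u by lia.
- by left; rewrite (parent_unique uv).
- by right; rewrite (parent_unique vu).
Qed.

Lemma children_parent v w : children o v w <-> w <> o /\ parent w = v.
Proof.
split=> [[vw lw]|[wo <-]].
  by split; [move=> wo; move: lw; rewrite wo lev_root|exact: parent_unique].
by have [] := parentP wo.
Qed.

Lemma finite_children v : finite_set (children o v).
Proof. by apply: sub_finite_set (lfT v) => w []. Qed.

Lemma lev_iter n v : lev (iter n parent v) = lev v - n.
Proof. by elim: n => [|n IH] /=; rewrite ?subn0// lev_parent IH subnS. Qed.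

(** Truncated subtraction makes [anc n v] equal to [v] itself when [n] exceeds the level of [v]. *)
Definition anc n v : T := iter (lev v - n) parent v.

Definition desc u v : bool := anc (lev u) v == u.

Lemma lev_anc n v : n <= lev v -> lev (anc n v) = n.
Proof. by move=> nv; rewrite lev_iter subKn. Qed.

Lemma anc_lev v : anc (lev v) v = v.
Proof. by rewrite /anc subnn. Qed.

Lemma anc_id n v : lev v <= n -> anc n v = v.
Proof. by rewrite /anc -subn_eq0 => /eqP->. Qed.

Lemma anc0 v : anc 0 v = o.
Proof. by apply: lev_eq0; rewrite lev_anc. Qed.

Lemma anc_parent n v : n < lev v -> anc n v = anc n (parent v).
Proof.
move=> nv; rewrite /anc lev_parent.
by rewrite (_ : lev v - n = ((lev v).-1 - n).+1) ?iterSr//; lia.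
Qed.

Lemma parent_anc n v : n < lev v -> parent (anc n.+1 v) = anc n v.
Proof.
by move=> nv; rewrite /anc -iterS; congr (iter _ parent v); lia.
Qed.

Lemma anc_anc m n v : m <= n -> anc m (anc n v) = anc m v.
Proof.
move=> mn; rewrite /anc lev_iter -iterD; congr (iter _ parent v); lia.
Qed.

Lemma desc_lev u v : desc u v -> lev u <= lev v.
Proof.
by rewrite leqNgt => /eqP uv; apply/negP => vu; move: (vu); rewrite -uv anc_id ?ltnn// ltnW.
Qed.

Lemma desc_refl u : desc u u.
Proof. by rewrite /desc anc_lev. Qed.

Lemma desc_root u : desc o u.
Proof. by rewrite /desc lev_root anc0. Qed.

Lemma anc_desc n v : desc (anc n v) v.
Proof.
have [nv|/ltnW vn] := leqP n (lev v); first by rewrite /desc lev_anc.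
by rewrite anc_id// desc_refl.
Qed.

Lemma desc_trans u v w : desc u v -> desc v w -> desc u w.
Proof.
move=> uv vw; rewrite /desc -(anc_anc w (desc_lev uv)).
by move: vw; rewrite /desc => /eqP ->.
Qed.

Lemma desc_parent u v : desc u v -> u <> v -> desc u (parent v).
Proof.
move=> uv E; rewrite /desc -anc_parent//.
rewrite ltn_neqAle (desc_lev uv) andbT; apply/negP => /eqP luv.
by apply: E; move: uv; rewrite /desc luv anc_lev => /eqP ->.
Qed.

Lemma desc_child u v : desc u (parent v) -> desc u v.
Proof.
move=> uv; apply: desc_trans uv _.
rewrite -[X in desc X v](_ : anc (lev v).-1 v = parent v); first exact: anc_desc.
have [->|vo] := eqVneq v o; first by rewrite anc_id ?parent_root// lev_root.
have : lev v <> 0 by move=> /lev_eq0 /eqP; apply/negP.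
by rewrite /anc => v0; rewrite (_ : _ - _ = 1)//; lia.
Qed.

(** The ancestors of [x] form a chain with one vertex at each level, so levels decide which lies
    above which. *)
Lemma desc_comparable u v x : desc u x -> desc v x -> lev u <= lev v -> desc u v.
Proof.
move=> ux vx uv.
rewrite /desc -(eqP vx) anc_anc//.
Qed.

(** The only edge leaving the subtree of [a] joins [a] to its parent: the walk must climb to [a] and
    then take one more step, whence the strict inequality. *)
Lemma walk_leaves_subtree a n u v : walk (@adj T) n u v ->
  desc a u -> ~~ desc a v -> lev u < n + lev a.
Proof.
case=> s [+ <- <-] {n v}; elim: s u => [|w s IH] u /=; first by move=> _ ->.
case/andP => uw ps au av.
have [aw|aw] := boolP (desc a w).
  by have := IH _ ps aw av; have := lev_adj (_ : adj w u); rewrite adj_sym => /(_ uw); lia.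
suff -> : u = a by lia.
have [[pw _]|[pu _]] := adj_parent uw.
  by case/negP: aw; apply: desc_child; rewrite pw.
apply/eqP/negPn/negP => ua; case/negP: aw; rewrite -pu desc_parent// => E.
by rewrite E eqxx in ua.
Qed.

(** * Spheres, balls and finiteness *)

Definition sphere n : set T := [set v | lev v = n].

Lemma sphereS n : sphere n.+1 = \bigcup_(v in sphere n) children o v.
Proof.
apply/seteqP; split => [w wn|w [v vn [_ wv]]]; last by rewrite /sphere /= wv vn.
have wo : w <> o by move=> wo; move: wn; rewrite wo /sphere /= lev_root.
have [pw lw] := parentP wo.
exists (parent w); first by rewrite /sphere/= lev_parent wn.
exact/children_parent.
Qed.

Lemma finite_sphere n : finite_set (sphere n).
Proof.
elim: n => [|n IH]; last first.
  by rewrite sphereS; apply: bigcup_finite => // v _; exact: finite_children.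
by apply: sub_finite_set (finite_set1 o) => v /lev_eq0 ->.
Qed.

Lemma countable_vertices : countable [set: T].
Proof.
rewrite (_ : setT = \bigcup_n sphere n).
  apply: bigcup_countable => // n _; exact/finite_set_countable/finite_sphere.
by apply/seteqP; split => // v _; exists (lev v).
Qed.

Lemma finite_ball n : finite_set [set v | lev v <= n].
Proof.
apply: sub_finite_set (bigcup_finite (finite_II n.+1) (fun i _ => finite_sphere i)).
by move=> v vn; exists (lev v).
Qed.

Lemma infinite_unbounded (A : set T) :
  infinite_set A -> forall n, exists2 v, A v & n <= lev v.
Proof.
move=> infA n; apply: contrapT => h; apply: infA.
apply: sub_finite_set (finite_ball n) => v Av /=.
by rewrite leqNgt; apply/negP => /ltnW nv; apply: h; exists v.
Qed.

Lemma unbounded_infinite (A : set T) :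
  (forall n, exists2 v, A v & n <= lev v) -> infinite_set A.
Proof.
move=> h /finite_seqP[s As].
have [v Av] := h (\max_(w <- s) lev w).+1.
rewrite ltnNge => /negP; apply.
by rewrite As in Av; apply: leq_bigmax_seq.
Qed.

End rooted_tree.

(** * Path events *)

Section events.
Variables (T : sgraph) (o : T).
Hypotheses (treeT : is_tree T) (lfT : locally_finite T).

Implicit Types u v x y z : T.

Local Notation lev v := (dist o v).
Local Notation parent := (parent o).
Local Notation anc := (anc o).
Local Notation desc := (desc o).

(** Each edge is named by its endpoint farther from the root, so that edges are indexed by the
    non-root vertices; the value at [o] is arbitrary. *)
Definition upper_edges (pe : T -> edge T) : Prop :=
  forall v, v <> o -> val (pe v) = [set parent v; v].

Lemma upper_edges_exist : infinite_set [set: T] -> exists pe, upper_edges pe.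
Proof.
move=> infT; have ex v : v <> o -> edges [set parent v; v].
  by move=> vo; exists (parent v), v; have [] := parentP treeT vo.
(* [pe o] must also be some edge; the upper edge of any vertex at positive level can serve. *)
have [v0 _ lv0] := infinite_unbounded o treeT lfT infT 1.
have v0o : v0 <> o by move=> v0o; rewrite v0o lev_root in lv0.
have /choice[pe peP] : forall v, exists e : edge T, v <> o -> val e = [set parent v; v].
  move=> v; have [vo|vo] := pselect (v <> o).
    by exists (@exist _ (fun A => A \in @edges T) _ (mem_set (ex v vo))).
  by exists (@exist _ (fun A => A \in @edges T) _ (mem_set (ex v0 v0o))).
by exists pe.
Qed.

Variable pe : T -> edge T.
Hypothesis peP : upper_edges pe.

(** Distinct vertices with the same upper edge would each be the parent of the other, which their
    levels exclude. *)
Lemma pe_inj v v' : v <> o -> v' <> o -> pe v = pe v' -> v = v'.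
Proof.
move=> vo vo' E.
have [_ lv] := parentP treeT vo; have [_ lv'] := parentP treeT vo'.
have := peP vo; rewrite E peP// => F.
have : [set parent v'; v'] v by rewrite F; right.
have : [set parent v; v] v' by rewrite -F; right.
by case=> [v'E|->//] [vE|//]; move: lv lv'; rewrite -v'E -vE; lia.
Qed.

Lemma pe_surj e : exists2 v, v <> o & e = pe v.
Proof.
have [u [v [uv eE]]] := set_mem (valP e).
have := uv; rewrite adj_sym => vu.
have no_root u' v' : lev v' = (lev u').+1 -> v' <> o.
  by move=> + vo'; rewrite vo' lev_root.
have [[pv lv]|[pu lu]] := adj_parent o treeT uv.
- exists v; first exact: no_root lv.
  by apply: val_inj => /=; rewrite peP ?pv//; exact: no_root lv.
- exists u; first exact: no_root lu.
  by apply: val_inj => /=; rewrite peP ?pu 1?setUC//; exact: no_root lu.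
Qed.

Lemma open_adj_parent (w : config T) v : v <> o -> open_adj w (parent v) v = w (pe v).
Proof.
move=> vo; apply/asboolP/idP => [[e eE we]|wv]; last first.
  by exists (pe v) => //; rewrite peP.
by rewrite (_ : pe v = e)//; apply: val_inj; rewrite /= peP.
Qed.

Lemma open_adj_sym (w : config T) u v : open_adj w u v = open_adj w v u.
Proof. by rewrite /open_adj [[set v; u]]setUC. Qed.

Lemma open_adj_adj (w : config T) u v : open_adj w u v -> adj u v.
Proof.
move=> /asboolP[e + we].
have [a [b [ab ->]]] := set_mem (valP e).
move=> E.
have : [set u; v] a by rewrite -E; left.
have : [set u; v] b by rewrite -E; right.
have : [set a; b] u by rewrite E; left.
have : [set a; b] v by rewrite E; right.
have neq : a <> b by move=> eab; move: ab; rewrite eab adj_irr.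
by move=> [->|->] [->|->] [h|h] [h'|h']; rewrite ?h ?h' // in ab neq *; rewrite ?ab// adj_sym.
Qed.

Definition all_open (s : seq T) : set (config T) :=
  [set w | all (fun v => w (pe v)) s].

Lemma measurable_status (e : edge T) (b : bool) :
  measurable ([set w | w e = b] : set (config T)).
Proof. by apply: sub_sigma_algebra; exists e, b. Qed.

Lemma measurable_open_at (e : edge T) : measurable (open_at e).
Proof. exact: (measurable_status e true). Qed.

Lemma all_open_bigcap s : all_open s = \bigcap_(v in [set` s]) open_at (pe v).
Proof.
apply/seteqP; split => w; first by move=> /allP ws v vs; exact: ws.
by move=> ws; apply/allP => v vs; exact: ws.
Qed.

Lemma measurable_all_open s : measurable (all_open s).
Proof.
rewrite all_open_bigcap; apply: fin_bigcap_measurable => //.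
by move=> v _; exact: measurable_open_at.
Qed.

Lemma all_open_cat s t : all_open (s ++ t) = all_open s `&` all_open t.
Proof.
apply/seteqP; split => w; rewrite /all_open /setI/= all_cat; first by move/andP.
by case=> -> ->.
Qed.

Lemma all_open_sub s t : {subset s <= t} -> all_open t `<=` all_open s.
Proof. by move=> st w /allP wt; apply/allP => v /st; exact: wt. Qed.

Lemma all_open_increasing s : increasing (all_open s).
Proof.
move=> w w' /allP ws ww'; apply/allP => v /ws; exact/implyP.
Qed.

(* The vertices [v] whose upper edges form the path from the ancestor of [x] at
   level [m] down to [x]. *)
Definition branch (m : nat) x : seq T := traject parent x (lev x - m).

Lemma mem_branch m x v : (v \in branch m x) = desc v x && (m < lev v)%N.
Proof.
apply/trajectP/andP => [[i im ->]|[vx mv]].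
  rewrite lev_iter//; split; last by lia.
  by rewrite /desc /anc lev_iter// subKn//; lia.
have lvx := desc_lev vx.
by exists (lev x - lev v)%N; [lia|exact/esym/eqP].
Qed.

Lemma branch_nonroot m x v : v \in branch m x -> v <> o.
Proof. by rewrite mem_branch => /andP[_] + vo; rewrite vo lev_root. Qed.

(** Levels drop by one at each step along the branch, so the list of levels, a reversed [iota], has
    no repetition. *)
Lemma uniq_branch m x : uniq (branch m x).
Proof.
apply: (@map_uniq _ _ (fun v => lev v)).
rewrite (_ : [seq _ | _ <- _] = traject predn (lev x) (lev x - m)); last first.
  rewrite /branch; move: (lev x - m)%N => n; elim: n x => //= n IH x.
  by rewrite IH lev_parent.
rewrite (_ : traject _ _ _ = rev (iota m.+1 (lev x - m))) ?rev_uniq ?iota_uniq//.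
have [n nE] : exists n, n = (lev x - m)%N by exists (lev x - m)%N.
rewrite -nE; elim: n x nE => // n IH x nE.
rewrite -addn1 iotaD rev_cat addn1 [LHS]/= [rev _]/= cat1s; congr cons; first by lia.
by rewrite -(lev_parent o treeT) IH// (lev_parent o treeT) -subn1 subnAC -nE subn1.
Qed.

Lemma branch_cat m l x : (m <= l <= lev x)%N ->
  branch m x = branch l x ++ branch m (anc l x).
Proof.
move=> /andP[ml lx]; rewrite /branch lev_anc//.
by rewrite -[in RHS]/(anc l x) -trajectD; congr traject; lia.
Qed.

Lemma size_branch m x : size (branch m x) = (lev x - m)%N.
Proof. by rewrite size_traject. Qed.

(** The clause [desc u x] does not depend on the configuration; it makes the event empty when [x] is
    not below [u]. *)
Definition reach u x : set (config T) :=
  [set w | desc u x /\ all_open (branch (lev u) x) w].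

Lemma measurable_reach u x : measurable (reach u x).
Proof.
have [ux|ux] := boolP (desc u x).
  rewrite (_ : reach u x = all_open (branch (lev u) x)); first exact: measurable_all_open.
  by apply/seteqP; split => [w []//|w]; split.
by rewrite (_ : reach u x = set0) -?subset0// => w [/(negP ux)].
Qed.

(* [u] is joined to infinity below [v] by open paths going away from the root. *)
Definition through u v : set (config T) :=
  \bigcap_n \bigcup_(x in [set x | desc v x /\ (n <= lev x)%N]) reach u x.

Lemma measurable_through u v : measurable (through u v).
Proof.
apply: bigcapT_measurable => n.
rewrite bigcup_mkcond; apply: countable_bigcupT_measurable => [|x].
  exact: countable_vertices.
by case: ifP => // _; exact: measurable_reach.
Qed.

Lemma reach_child w u x y : parent y = x -> y <> o -> open_adj w x y ->
  reach u x w -> reach u y w.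
Proof.
move=> pyx yo wy [ux wx]; split.
  by apply: desc_child => //; rewrite pyx.
have ly : lev y = (lev x).+1 by have [_ <-] := parentP treeT yo; rewrite pyx.
have lux := desc_lev ux.
rewrite /branch ly subSn//; apply/andP; split; last by rewrite pyx.
by rewrite -open_adj_parent// pyx.
Qed.

Lemma reach_joined w u x : reach u x w -> joined (open_adj w) u x.
Proof.
have [n nE] : exists n, n = (lev x - lev u)%N by exists (lev x - lev u)%N.
elim: n x nE => [|n IH] x nE [ux wx].
  suff -> : u = x by exists 0%N, [::].
  by move: ux; rewrite /desc /anc -nE => /eqP.
have xo : x <> o by move=> xo; move: nE; rewrite xo lev_root.
have [_ lx] := parentP treeT xo.
move: wx; rewrite /all_open /branch -nE /= => /andP[wx wpx].
have nE' : n = (lev (parent x) - lev u)%N by lia.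
have [|k [s [ps ls ss]]] := IH (parent x) nE'.
  split; last by rewrite /all_open /branch -nE'.
  by apply: desc_parent => // uE; move: nE; rewrite uE subnn.
exists k.+1, (rcons s x).
by rewrite rcons_path ps ls last_rcons size_rcons ss open_adj_parent.
Qed.

(** In an infinite cluster take a vertex [u] of least level: the whole cluster is then reached from
    [u] by open paths going down, and local finiteness gives it vertices at arbitrarily large
    levels. *)
Lemma percolation_eventE : @percolation_event T = \bigcup_u through u u.
Proof.
apply/seteqP; split => w; last first.
  move=> [u _ wu]; exists u.
  apply: (unbounded_infinite (o := o)) => // n.
  by have [x [_ nx] /reach_joined jx] := wu n I; exists x.
move=> [v infv].
have ex : exists n, `[< exists2 u, Defs.cluster w v u & lev u = n >].
  by exists (lev v); apply/asboolP; exists v => //; exists 0%N, [::].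
case: (ex_minnP ex) => m /asboolP[u [k [s [ps ls ss]]] lu] umin.
have uminP x : Defs.cluster w v x -> (lev u <= lev x)%N.
  by move=> cx; rewrite lu; apply: umin; apply/asboolP; exists x.
have ru x : Defs.cluster w v x -> reach u x w.
  (* Along an open walk, a step away from the root lengthens the open path from [u] and a step
     towards the root shortens it; minimality of the level of [u] keeps the walk from rising above
     [u]. *)
  have back : forall s' z, path (open_adj w) z s' ->
      Defs.cluster w v z -> reach u z w -> reach u (last z s') w.
    elim=> // y s' IH z /= /andP[zy ps'] cz rz.
    have cy : Defs.cluster w v y.
      move: cz => [n [t [pt lt st]]]; exists n.+1, (rcons t y).
      by rewrite rcons_path pt lt zy last_rcons size_rcons st.
    apply: IH => //.
    have [[py ly]|[pz lz]] := adj_parent o treeT (open_adj_adj zy).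
      by apply: reach_child rz => // yo; rewrite yo lev_root in ly.
    case: rz => uz wz.
    have luy := uminP _ cy.
    split; first by rewrite -pz; apply: desc_parent => // uE; move: luy; rewrite uE lz; lia.
    apply: all_open_sub wz => t.
    rewrite !mem_branch => /andP[ty ->]; rewrite andbT.
    by apply: desc_child => //; rewrite pz.
  have uv : exists2 s', path (open_adj w) u s' & last u s' = v.
    exists (rev (belast v s)).
      rewrite -ls rev_path; apply: sub_path ps => a b /=.
      by rewrite open_adj_sym.
    case: (s) ls => [|a s'] //= _; by rewrite rev_cons last_rcons.
  have cu : Defs.cluster w v u by exists k, s.
  have ruu : reach u u w by split; [exact: desc_refl|rewrite /all_open /branch subnn].
  have [s' ps' ls'] := uv.
  have rv : reach u v w by rewrite -ls'; exact: back.
  move=> [n [t [pt <- _]]]; apply: back => //.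
  by exists 0%N, [::].
exists u => // n _.
have [x cx nx] := infinite_unbounded o treeT lfT infv n.
by have rx := ru _ cx; exists x => //; split => //; case: rx.
Qed.

Lemma measurable_percolation_event : measurable (@percolation_event T).
Proof.
rewrite percolation_eventE; apply: countable_bigcupT_measurable => [|u].
  exact: countable_vertices.
exact: measurable_through.
Qed.

(** Koenig's argument: if every child [v'] were a dead end from some level [f v'] on, then so would
    be [v], since it has finitely many children. *)
Lemma through_children u v :
  through u v `<=` \bigcup_(v' in children o v) through u v'.
Proof.
move=> w wv; apply: contrapT => h.
have {h} h v' : children o v v' -> exists n, forall x,
    desc v' x -> (n <= lev x)%N -> ~ reach u x w.
  move=> cv'; apply: contrapT => hn; apply: h; exists v' => // n _.
  apply: contrapT => hx; apply: hn; exists n => x vx nx rx.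
  by apply: hx; exists x.
have {h} /choice[f fP] : forall v', exists n, children o v v' -> forall x,
    desc v' x -> (n <= lev x)%N -> ~ reach u x w.
  move=> v'; have [/h[n nP]|nc] := pselect (children o v v'); first by exists n.
  by exists 0%N.
have [s sE] := (finite_seqP _).1 (finite_children o lfT v).
(* A level of at least [(lev v).+1] puts [x] below a child of [v]; the maximum puts it beyond all
   the bounds [f]. *)
have [x [vx nx] rx] := wv (maxn (lev v).+1 (\max_(v' <- s) f v')) I.
move: nx; rewrite geq_max => /andP[lvx mx].
have cx : children o v (anc (lev v).+1 x).
  apply/children_parent => //; split; last by rewrite parent_anc//; exact/eqP.
  by move=> E; have := lev_anc treeT lvx; rewrite E lev_root.
apply: (fP _ cx x) rx; first exact: anc_desc.
apply: leq_trans mx; apply: leq_bigmax_seq => //.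
by rewrite sE in cx.
Qed.

End events.

(** * The second moment method *)

Section finite_combinations.
Context d (O : measurableType d) (R : realType) (P : probability O R).

Lemma probability_fineK (A : set O) : measurable A -> (fine (P A))%:E = P A.
Proof. by move=> mA; rewrite fineK// fin_num_measure. Qed.

Lemma fine_probability_ge0 (A : set O) : 0 <= fine (P A).
Proof. exact/fine_ge0/measure_ge0. Qed.

Lemma fine_probability_le (A B : set O) : measurable A -> measurable B ->
  A `<=` B -> fine (P A) <= fine (P B).
Proof.
move=> mA mB AB; apply: fine_le; rewrite ?fin_num_measure//.
by apply: le_measure; rewrite ?inE.
Qed.

(** Linear inequalities that hold pointwise between indicators pass to probabilities by
    integration. *)
Lemma indic_combination_ge0 (I : Type) (s : seq I) (c : I -> R) (A : I -> set O) :
  (forall i, measurable (A i)) ->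
  (forall w, 0 <= \sum_(i <- s) c i * \1_(A i) w) ->
  0 <= \sum_(i <- s) c i * fine (P (A i)).
Proof.
move=> mA h.
have iA i : P.-integrable setT (EFin \o (\1_(A i) : O -> R)).
  by apply: integrable_indic => //; rewrite probability_setT ltry.
rewrite -lee_fin -sumEFin.
have -> : (\sum_(i <- s) (c i * fine (P (A i)))%:E)%E =
    (\int[P]_w (\sum_(i <- s) (c i)%:E * (\1_(A i) w)%:E))%E.
  rewrite integral_sum//; last by move=> i; exact/integrableZl/iA.
  apply: eq_bigr => i _; rewrite integralZl//; last exact: iA.
  by rewrite integral_indic// setIT EFinM probability_fineK.
apply: integral_ge0 => w _.
by under eq_bigr do rewrite -EFinM; rewrite sumEFin lee_fin.
Qed.

(* Integrate [1_U >= 2 t X - t ^ 2 X ^ 2] with [t = 1 / K], where [X] is the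
   weighted sum of the indicators, which vanishes off their union [U]. *)
Lemma second_moment (I : eqType) (s : seq I) (c : I -> R) (A : I -> set O) (K : R) :
  (forall i, measurable (A i)) -> 0 < K ->
  \sum_(i <- s) c i * fine (P (A i)) = 1 ->
  \sum_(i <- s) \sum_(j <- s) c i * c j * fine (P (A i `&` A j)) <= K ->
  K^-1 <= fine (P (\bigcup_(i in [set` s]) A i)).
Proof.
move=> mA K0 m1 m2.
pose U := \bigcup_(i in [set` s]) A i.
have mU : measurable U by apply: fin_bigcup_measurable.
(* [J] indexes the terms of [1_U - 2 X / K + X ^ 2 / K ^ 2], which becomes a single combination of
   indicators: of [U], of the single events and of their pairwise intersections. *)
pose J : Type := option (I + I * I).
pose B (j : J) : set O := match j with
  | None => U | Some (inl i) => A i | Some (inr ij) => A ij.1 `&` A ij.2 end.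
pose e (j : J) : R := match j with
  | None => 1 | Some (inl i) => - (2 / K) * c i
  | Some (inr ij) => K ^- 2 * (c ij.1 * c ij.2) end.
pose r : seq J := None :: map Some (map inl s ++ map inr [seq (i, j) | i <- s, j <- s]).
have mB j : measurable (B j) by case: j => [[i|[i j]]|]//=; exact: measurableI.
have sumE (f : set O -> R) : \sum_(j <- r) e j * f (B j) = f U
    + - (2 / K) * (\sum_(i <- s) c i * f (A i))
    + K ^- 2 * (\sum_(i <- s) \sum_(j <- s) c i * c j * f (A i `&` A j)).
  rewrite big_cons mul1r -addrA; congr +%R.
  rewrite big_map big_cat !big_map big_allpairs !mulr_sumr /=; congr +%R.
    by apply: eq_bigr => i _; rewrite mulrA.
  by apply: eq_bigr => i _; rewrite mulr_sumr; apply: eq_bigr => j _; rewrite !mulrA.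
have := @indic_combination_ge0 J r e B mB.
rewrite (sumE (fun X => fine (P X))) m1 => h.
have : 0 <= fine (P U) + - (2 / K) * 1 + K ^- 2 *
    (\sum_(i <- s) \sum_(j <- s) c i * c j * fine (P (A i `&` A j))).
  apply: h => w; rewrite (sumE (fun X => \1_X w)).
  set X := \sum_(i <- s) c i * \1_(A i) w.
  have -> : \sum_(i <- s) \sum_(j <- s) c i * c j * \1_(A i `&` A j) w = X ^+ 2.
    rewrite expr2 big_distrlr; apply: eq_bigr => i _; apply: eq_bigr => j _.
    by rewrite indicI/=; ring.
  (* On [U] the combination is the square of [1 - X / K]; off [U] every indicator in it vanishes. *)
  have [Uw|Uw] := pselect (U w).
    rewrite indicE mem_set//= (_ : _ + _ = (1 - X / K) ^+ 2) ?sqr_ge0//.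
    by field; rewrite gt_eqF.
  rewrite indicE memNset//= (_ : X = 0) ?expr0n/= ?mulr0 ?addr0//.
  rewrite /X big_seq big1// => i si; rewrite indicE memNset ?mulr0// => Aw.
  by apply: Uw; exists i.
have K2 : 0 <= K ^- 2 by rewrite invr_ge0 exprn_ge0// ltW.
move: m2 => /(ler_wpM2l K2) m2 h'.
have E : K ^- 2 * K = K^-1 by rewrite expr2 invfM -mulrA mulVf ?mulr1// gt_eqF.
rewrite E in m2; rewrite -/U; lra.
Qed.

End finite_combinations.

Section countable_union.
Context d (O : measurableType d) (R : realType) (P : probability O R).

Lemma countable_enum (T : choiceType) (o : T) : countable [set: T] ->
  exists (enc : T -> nat) (dec : nat -> T), cancel enc dec.
Proof.
move=> /countable_injP[enc enc_inj].
exists enc, (fun n => xget o [set v | enc v = n]) => v.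
apply: enc_inj; rewrite ?inE//.
by apply: (xgetPex o (P := [set u | enc u = enc v])); exists v.
Qed.

Lemma null_bigcup (T : choiceType) (o : T) (F : T -> set O) :
  countable [set: T] -> (forall v, measurable (F v)) ->
  (forall v, P (F v) = 0%E) -> P (\bigcup_v F v) = 0%E.
Proof.
move=> cT mF F0; have [enc [dec encK]] := countable_enum o cT.
have -> : \bigcup_v F v = \bigcup_n F (dec n).
  apply/seteqP; split=> [w [v _ Fv]|w [n _ Fn]]; last by exists (dec n).
  by exists (enc v) => //; rewrite encK.
apply/negligibleP; first by apply: bigcupT_measurable => n; exact: mF.
apply: negligible_bigcup => n; apply/negligibleP; first exact: mF.
exact: F0.
Qed.

End countable_union.

(** * Flows and sums over spheres *)

Section spheres.
Variables (T : sgraph) (o : T).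
Hypotheses (treeT : is_tree T) (lfT : locally_finite T).

Implicit Types u v x y z : T.

Local Notation lev v := (dist o v).
Local Notation parent := (parent o).
Local Notation anc := (anc o).
Local Notation desc := (desc o).

Definition sph n : seq T := finmap.enum_fset (fset_set (sphere o n)).

Lemma mem_sph n x : (x \in sph n) = (lev x == n).
Proof.
rewrite (in_fset_set (finite_sphere o treeT lfT n)).
by apply/idP/eqP => [|xn]; rewrite inE.
Qed.

Lemma uniq_sph n : uniq (sph n).
Proof. exact: finmap.fset_uniq. Qed.

Lemma sum_children (R : nmodType) v (F : T -> R) n : lev v = n ->
  \sum_(w \in children o v) F w = \sum_(w <- sph n.+1 | parent w == v) F w.
Proof.
move=> vn; rewrite fsbig_finite; last exact: finite_children.
rewrite -[RHS]big_filter; apply: perm_big; apply: uniq_perm.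
- exact: finmap.fset_uniq.
- exact/filter_uniq/uniq_sph.
move=> w; rewrite in_fset_set; last exact: finite_children.
rewrite mem_filter mem_sph; apply/idP/andP => [|[/eqP pw /eqP wn]].
  rewrite inE => vw; have [_ pw] := (children_parent o treeT v w).1 vw.
  by move: vw => [_ ->]; rewrite pw vn.
rewrite inE; apply/children_parent => //; split => // wo.
by move: wn; rewrite wo lev_root.
Qed.

(** Every vertex at level [n.+1] is the child of exactly one vertex at level [n]. *)
Lemma sum_sphS (R : nmodType) (F : T -> R) n :
  \sum_(w <- sph n.+1) F w = \sum_(v <- sph n) \sum_(w \in children o v) F w.
Proof.
have -> : \sum_(v <- sph n) \sum_(w \in children o v) F w =
    \sum_(v <- sph n) \sum_(w <- sph n.+1 | parent w == v) F w.
  by rewrite !big_seq; apply: eq_bigr => v; rewrite mem_sph => /eqP vn; rewrite (sum_children _ vn).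
rewrite (exchange_big_dep xpredT)//= [LHS]big_seq [RHS]big_seq.
apply: eq_bigr => w; rewrite mem_sph => /eqP wn.
rewrite (big_rem (parent w))/=; last by rewrite mem_sph lev_parent// wn.
rewrite eqxx big_seq_cond big1 ?addr0// => v /andP[vr /eqP E].
by move: vr; rewrite -E mem_rem_uniqF// uniq_sph.
Qed.

Variable R : realType.
Variable theta : T -> R.
Hypothesis flow_theta : flow o theta.

(** By conservation, the flow entering [z] passes undiminished through each deeper level of its
    subtree. *)
Lemma flow_sphere z n : (lev z <= n)%N ->
  \sum_(x <- sph n | desc z x) theta x = theta z.
Proof.
move=> /subnK <-; elim: (n - lev z)%N => [|k IH].
  rewrite add0n (big_rem z)/=; last by rewrite mem_sph.
  rewrite desc_refl big_seq_cond big1 ?addr0// => x /andP[xr zx].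
  have xz : x = z.
    have := mem_rem xr; rewrite mem_sph => /eqP xz.
    by move: zx; rewrite /desc -xz anc_lev => /eqP.
  by move: xr; rewrite xz mem_rem_uniqF// uniq_sph.
rewrite addSn big_mkcond sum_sphS -[RHS]IH [RHS]big_mkcond.
rewrite big_seq [RHS]big_seq; apply: eq_bigr => v; rewrite mem_sph => /eqP vn.
rewrite (flow_theta v).2.
(* As [v] is at least as deep as [z], its children lie below [z] exactly when [v] does. *)
have E w : w \in children o v -> desc z w = desc z v.
  rewrite inE => vw; have [wo pw] := (children_parent o treeT v w).1 vw.
  apply/idP/idP => [zw|]; last by rewrite -pw; exact: desc_child.
  rewrite -pw; apply: desc_parent => // zw'.
  by move: vw => [_]; rewrite -zw' vn; lia.
case: ifP => zv; first by apply: eq_fsbigr => w /E ->; rewrite zv.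
by rewrite fsbig1// => w vw; rewrite E ?inE// zv.
Qed.

Lemma flow_sphere_root n : \sum_(x <- sph n) theta x = theta o.
Proof.
rewrite -(flow_sphere (z := o) (n := n)) ?lev_root//.
by apply: eq_bigl => x; rewrite desc_root.
Qed.

(** Take the deepest level at which the ancestors of [x] and [y] coincide. *)
Lemma meet_exists x y : exists z, [/\ desc z x, desc z y &
  forall a, desc a x -> desc a y -> (lev a <= lev z)%N].
Proof.
pose Q m := (m <= lev x)%N && (anc m x == anc m y).
have exQ : exists m, Q m by exists 0%N; rewrite /Q !anc0// eqxx.
case: (@ex_maxnP Q (lev x) exQ) => [m /andP[]//|m /andP[mx /eqP E] mmax].
exists (anc m x); split; [exact: anc_desc|by rewrite E anc_desc|].
move=> a ax ay; rewrite lev_anc//; apply: mmax.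
rewrite /Q desc_lev//=; apply/eqP; rewrite (eqP ax); exact/esym/eqP.
Qed.

(** By [flow_sphere], [theta z ^+ 2] is the sum of [theta x * theta y] over the pairs below [z]. The
    right side thus counts each pair once for every common ancestor, and [mt x y] is one of
    these. *)
Lemma energy_bound (mt : T -> T -> T) (h : T -> R) n :
  (forall x y, desc (mt x y) x /\ desc (mt x y) y) -> (forall z, 0 <= h z) ->
  \sum_(x <- sph n) \sum_(y <- sph n) theta x * theta y * h (mt x y) <=
  \sum_(m < n.+1) \sum_(z <- sph m) h z * theta z ^+ 2.
Proof.
move=> mtP h0.
have th0 x : 0 <= theta x by have [] := flow_theta x.
have -> : \sum_(m < n.+1) \sum_(z <- sph m) h z * theta z ^+ 2 =
    \sum_(x <- sph n) \sum_(y <- sph n) theta x * theta y *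
      \sum_(m < n.+1) \sum_(z <- sph m) (desc z x && desc z y)%:R * h z.
  under [RHS]eq_bigr => x _.
    under eq_bigr => y _.
      rewrite mulr_sumr; under eq_bigr do rewrite mulr_sumr.
      over.
    rewrite exchange_big /=; under eq_bigr do rewrite exchange_big /=.
    over.
  rewrite exchange_big /=; apply: eq_bigr => m _.
  rewrite exchange_big /= !big_seq; apply: eq_bigr => z; rewrite mem_sph => /eqP zm.
  rewrite -(flow_sphere (z := z) (n := n)); last by rewrite zm -ltnS.
  rewrite expr2 big_mkcond big_distrlr mulr_sumr; apply: eq_bigr => x _.
  rewrite mulr_sumr; apply: eq_bigr => y _.
  by case: (desc z x); case: (desc z y) => /=; ring.
rewrite big_seq [leRHS]big_seq; apply: ler_sum => x; rewrite mem_sph => /eqP xn.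
apply: ler_sum => y _; apply: ler_wpM2l; first exact: mulr_ge0.
have [mx my] := mtP x y.
have lm : (lev (mt x y) < n.+1)%N by rewrite ltnS -xn desc_lev.
have nn z : 0 <= (desc z x && desc z y)%:R * h z by rewrite mulr_ge0.
(* Only the term of [mt x y] at its own level is kept; the others are nonnegative. *)
rewrite (bigD1 (Ordinal lm))//= (big_rem (mt x y))/=; last by rewrite mem_sph.
rewrite mx my mul1r -addrA lerDl addr_ge0// ?sumr_ge0// => i _.
exact: sumr_ge0.
Qed.

End spheres.

(** * Percolation from a decaying flow *)

Section percolation_from_flow.
Variables (T : sgraph) (o : T).
Hypotheses (treeT : is_tree T) (lfT : locally_finite T).

Implicit Types u v x y z : T.

Local Notation lev v := (dist o v).
Local Notation parent := (parent o).
Local Notation anc := (anc o).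
Local Notation desc := (desc o).

Variable pe : T -> edge T.
Hypothesis peP : upper_edges o pe.
Variables (R : realType) (P : probability (config T) R).

(** The form in which finite range enters: edges outside the subtree of [a] against edges at least
    [k] levels inside it. Bernoulli percolation satisfies it with [k = 0]. *)
Definition subtree_independent (k : nat) : Prop := forall (a : T) (s t : seq T),
  (forall v, v \in s -> v <> o /\ ~~ desc a v) ->
  (forall v, v \in t -> [/\ v <> o, desc a v & (lev a + k <= lev v)%N]) ->
  uniq s -> uniq t ->
  P (all_open pe s `&` all_open pe t) = (P (all_open pe s) * P (all_open pe t))%E.

(** Positive association for two disjoint finite sets of edges being open; disjointness gives
    equality for Bernoulli percolation. *)
Definition open_correlated : Prop := forall s t : seq T,
  (forall v, v \in s ++ t -> v <> o) -> uniq (s ++ t) ->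
  (P (all_open pe s) * P (all_open pe t) <= P (all_open pe s `&` all_open pe t))%E.

Variables (k : nat) (p : R).
Hypotheses (indP : subtree_independent k) (corP : open_correlated).
Hypotheses (p0 : 0 < p) (p1 : p <= 1).
Hypothesis margP : forall e, P (open_at e) = p%:E.

Local Notation pr A := (fine (P A)).
Local Notation br_open m x := (all_open pe (branch o m x)).

Lemma pr_cor s t : (forall v, v \in s ++ t -> v <> o) -> uniq (s ++ t) ->
  pr (all_open pe s) * pr (all_open pe t) <= pr (all_open pe (s ++ t)).
Proof.
move=> st ust; rewrite all_open_cat -lee_fin EFinM !probability_fineK ?corP//.
all: try exact: measurable_all_open.
by apply: measurableI; exact: measurable_all_open.
Qed.

Lemma pr_nil : pr (all_open pe [::]) = 1.
Proof.
rewrite (_ : all_open pe [::] = setT) ?probability_setT//.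
by apply/seteqP; split.
Qed.

(** By positive correlation, each further edge costs at most a factor [p]. *)
Lemma pr_ge_expr s : (forall v, v \in s -> v <> o) -> uniq s ->
  p ^+ size s <= pr (all_open pe s).
Proof.
elim: s => [|v s IH] sP; first by rewrite pr_nil.
move=> /[dup] U /= /andP[vs us].
apply: le_trans (@pr_cor [:: v] s sP U); rewrite exprS.
have -> : all_open pe [:: v] = open_at (pe v).
  by apply/seteqP; split => w /=; rewrite /all_open/= andbT.
rewrite margP ler_pM2l//; apply: IH => // u us'; apply: sP.
by rewrite inE us' orbT.
Qed.

Lemma pr_branch_ge m x : p ^+ (lev x - m) <= pr (br_open m x).
Proof.
rewrite -(size_branch o m x); apply: pr_ge_expr; last exact: uniq_branch.
by move=> v; exact: branch_nonroot.
Qed.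

Lemma pr_branch_gt0 m x : 0 < pr (br_open m x).
Proof. by apply: lt_le_trans (pr_branch_ge m x); exact: exprn_gt0. Qed.

Lemma pr_branch_cat m l x : (m <= l <= lev x)%N ->
  pr (br_open l x) * pr (br_open m (anc l x)) <= pr (br_open m x).
Proof.
move=> mlx; have E := branch_cat treeT mlx; rewrite E.
by apply: pr_cor; rewrite -E; [move=> v; exact: branch_nonroot|exact: uniq_branch].
Qed.

(** Dropping edges enlarges the event ([up]) and restoring them costs [p ^+ k] ([down]); chaining
    the two gives the bound free of divisions. *)
Lemma meet_correlation z x y : desc z x -> desc z y ->
    (forall a, desc a x -> desc a y -> (lev a <= lev z)%N) ->
  pr (br_open 0 x `&` br_open 0 y) * (p ^+ k * pr (br_open 0 z)) <=
  pr (br_open 0 x) * pr (br_open 0 y).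
Proof.
move=> zx zy zmax.
have mall s := measurable_all_open pe s.
(* [t] is the part of the branch more than [k] levels below [z]; it is empty when [x] is within [k]
   levels of [z]. *)
set t := branch o (lev z + k) x.
have sub : {subset t <= branch o 0 x}.
  move=> v; rewrite !mem_branch// => /andP[-> ?]; lia.
have indep : pr (br_open 0 y `&` all_open pe t) = pr (br_open 0 y) * pr (all_open pe t).
  rewrite -fineM ?fin_num_measure//; congr fine.
  have [xk|kx] := leqP (lev x) (lev z + k).
    have -> : t = [::] by rewrite /t /branch; move: xk; rewrite -subn_eq0 => /eqP ->.
    rewrite (_ : all_open pe [::] = setT) ?setIT ?probability_setT ?mule1//.
    by apply/seteqP; split.
  (* By maximality of [z], no vertex of the branch to [y] lies below the child of [z] towards [x].
     Vertices of [t] have level at least [lev z + k + 1], which is [k] more than that child. *)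
  have lax : lev (anc (lev z).+1 x) = (lev z).+1 by rewrite lev_anc//; lia.
  have dax : desc (anc (lev z).+1 x) x by exact: anc_desc.
  apply: (indP (a := anc (lev z).+1 x)); try exact: uniq_branch.
    move=> v vy; split; first by apply: branch_nonroot vy.
    move: vy; rewrite mem_branch// => /andP[vy _]; apply/negP => av.
    by have := zmax _ dax (desc_trans treeT av vy); rewrite lax ltnn.
  move=> v vt; split; first by apply: branch_nonroot vt.
    move: vt; rewrite mem_branch// => /andP[vx lv].
    by apply: (desc_comparable treeT dax vx); rewrite lax; lia.
  by move: vt; rewrite mem_branch// => /andP[vx lv]; rewrite lax; lia.
have up : pr (br_open 0 x `&` br_open 0 y) <= pr (br_open 0 y) * pr (all_open pe t).
  rewrite -indep; apply: fine_probability_le; try exact: measurableI.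
  by rewrite setIC; apply: setIS; exact: all_open_sub.
(* The branch to [x] consists of [t], at most [k] edges below [z], and the branch to [z]; the middle
   piece is open with probability at least [p ^+ k]. *)
have down : pr (all_open pe t) * (p ^+ k * pr (br_open 0 z)) <= pr (br_open 0 x).
  have lzx := desc_lev zx.
  pose l := minn (lev z + k) (lev x).
  have lx : (l <= lev x)%N by rewrite geq_minr.
  have tE : t = branch o l x.
    rewrite /t /branch /l; congr traject; lia.
  apply: le_trans (_ : pr (br_open l x) * pr (br_open 0 (anc l x)) <= _); last first.
    by apply: pr_branch_cat; rewrite lx.
  rewrite tE ler_pM2l ?pr_branch_gt0//.
  have zl : (lev z <= l)%N by rewrite leq_min leq_addr.
  have zlE : anc (lev z) (anc l x) = z by rewrite anc_anc//; exact/eqP.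
  apply: le_trans (_ : pr (br_open (lev z) (anc l x)) * pr (br_open 0 z) <= _); last first.
    by rewrite -{2}zlE; apply: pr_branch_cat => //; rewrite lev_anc.
  rewrite ler_pM2r ?pr_branch_gt0//; apply: le_trans (pr_branch_ge _ _).
  by apply: ler_wiXn2l => //; [exact: ltW|rewrite lev_anc// /l; lia].
rewrite [leRHS]mulrC; apply: le_trans (_ : pr (br_open 0 y) * pr (all_open pe t) *
  (p ^+ k * pr (br_open 0 z)) <= _).
  by apply: ler_wpM2r => //; apply: mulr_ge0; rewrite ?fine_probability_ge0// exprn_ge0// ltW.
by rewrite -mulrA; apply: ler_wpM2l down; exact: fine_probability_ge0.
Qed.

Lemma percolates_of_flow (theta : T -> R) (C l : R) :
  unit_flow o theta -> (forall v, theta v <= C * l ^- lev v) ->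
  1 < l * p -> percolates P.
Proof.
move=> [flow_theta theta1] thetaC lp1.
have l0 : 0 < l by rewrite -(pmulr_lgt0 _ p0) (lt_trans _ lp1).
have C0 : 0 < C.
  have := thetaC o; rewrite theta1 lev_root// expr0 invr1 mulr1.
  exact: lt_le_trans.
have th0 x : 0 <= theta x by have [] := flow_theta x.
have /choice[mt0 mt0P] : forall xy, exists z, [/\ desc z xy.1, desc z xy.2 &
  forall a, desc a xy.1 -> desc a xy.2 -> (lev a <= lev z)%N].
  by move=> [x y]; exact: meet_exists.
pose mt x y := mt0 (x, y).
(* The ratio of the geometric series: a factor [l^-1] from the decay of [theta] and [p^-1] from
   [pr_branch_ge]. *)
pose r := (l * p)^-1.
have r0 : 0 <= r by rewrite invr_ge0 ltW// (lt_trans _ lp1).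
have r1 : r < 1 by rewrite invf_lt1// (lt_trans _ lp1).
(* [p ^- k] comes from [meet_correlation], [C / (1 - r)] from the geometric series. *)
pose K := p ^- k * (C / (1 - r)).
have pk0 : 0 < p ^- k by rewrite invr_gt0 exprn_gt0.
have K0 : 0 < K by rewrite mulr_gt0// divr_gt0// subr_gt0.
pose A x := br_open 0 x.
have mA x : measurable (A x) by exact: measurable_all_open.
pose U n := \bigcup_(x in [set` sph o n]) A x.
have mU n : measurable (U n) by apply: fin_bigcup_measurable.
have PU n : K^-1 <= pr (U n).
  (* Dividing [theta x] by the probability of [A x] makes the first moment the total flow, which is
     1. *)
  apply: (@second_moment _ _ _ _ _ _ (fun x => theta x / pr (A x))) => //.
    under eq_bigr do rewrite divfK ?gt_eqF ?pr_branch_gt0//.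
    by rewrite flow_sphere_root.
  apply: le_trans (_ : p ^- k * \sum_(x <- sph o n) \sum_(y <- sph o n)
      theta x * theta y * (pr (A (mt x y)))^-1 <= _).
    rewrite mulr_sumr; apply: ler_sum => x _; rewrite mulr_sumr; apply: ler_sum => y _.
    have [zx zy zm] := mt0P (x, y).
    have := meet_correlation zx zy zm; rewrite -/(mt x y) -/(A x) -/(A y) -/(A (mt x y)).
    move=> h.
    rewrite (_ : theta x / _ * _ * _ = theta x * theta y *
        (pr (A x `&` A y) / (pr (A x) * pr (A y)))); last by rewrite invfM; ring.
    rewrite [leRHS](_ : _ = theta x * theta y * (p ^+ k * pr (A (mt x y)))^-1); last first.
      by rewrite invfM; ring.
    apply: ler_wpM2l; first exact: mulr_ge0.
    rewrite ler_pdivrMr ?mulr_gt0 ?pr_branch_gt0//.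
    by rewrite mulrC ler_pdivlMr// mulr_gt0 ?exprn_gt0 ?pr_branch_gt0.
  rewrite /K ler_pM2l//.
  have mtP x y : desc (mt x y) x /\ desc (mt x y) y by have [] := mt0P (x, y).
  have h0 z : 0 <= (pr (A z))^-1 by rewrite invr_ge0 fine_probability_ge0.
  apply: le_trans (energy_bound treeT lfT flow_theta n mtP h0) _.
  apply: le_trans (_ : \sum_(m < n.+1) C * r ^+ m <= _).
    apply: ler_sum => m _.
    (* One factor [theta z] is bounded by [C * l ^- m]; the other is kept, and sums to 1 over the
       sphere. *)
    apply: le_trans (_ : \sum_(z <- sph o m) C * r ^+ m * theta z <= _).
      rewrite big_seq [leRHS]big_seq; apply: ler_sum => z; rewrite mem_sph// => /eqP zm.
      rewrite expr2 mulrA; apply: ler_wpM2r => //.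
      rewrite /r exprVn exprMn invfM mulrA mulrC.
      apply: ler_pM => //; first by rewrite -zm thetaC.
      rewrite lef_pV2 ?posrE ?exprn_gt0 ?pr_branch_gt0//.
      by have := pr_branch_ge 0 z; rewrite subn0 zm.
    by rewrite -mulr_sumr flow_sphere_root// theta1 mulr1.
  rewrite -mulr_sumr ler_pM2l//.
  have -> : \sum_(m < n.+1) r ^+ m = (1 - r ^+ n.+1) / (1 - r).
    rewrite -opprB subrX1 -mulNr opprB mulrAC divff ?mul1r// subr_eq0 eq_sym lt_eqF//.
  rewrite ler_pdivrMr ?subr_gt0// mulVf ?subr_eq0 1?eq_sym ?lt_eqF//.
  by rewrite lerBlDr lerDl exprn_ge0.
(* An open path to level [n.+1] passes through level [n], so the [U n] decrease and continuity from
   above keeps the bound [K^-1]. *)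
have Uhomo : {homo U : n m / (n <= m)%N >-> (m <= n)%O}.
  apply/nonincreasing_seqP => n; apply/subsetPset => w [x xn wx].
  have xl : lev x = n.+1 by move: xn => /=; rewrite mem_sph// => /eqP.
  exists (anc n x); first by rewrite /= mem_sph// lev_anc// xl.
  apply: all_open_sub wx => v; rewrite !mem_branch// => /andP[vx ->].
  by rewrite (desc_trans treeT vx)// anc_desc.
have PI : (K^-1%:E <= P (\bigcap_n U n))%E.
  have cvgU := @nonincreasing_cvg_mu _ _ _ P U (le_lt_trans (probability_le1 P (mU 0%N)) (ltry 1))
    mU (bigcapT_measurable mU) Uhomo.
  rewrite -(cvg_lim _ cvgU)//; apply: lime_ge; first by apply/cvg_ex; eexists; exact: cvgU.
  by apply: nearW => n /=; rewrite -(probability_fineK P (mU n)) lee_fin.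
apply: lt_le_trans (_ : (0 < K^-1%:E)%E) _; first by rewrite lte_fin invr_gt0.
apply: le_trans PI _; apply: le_measure; rewrite ?inE.
- exact: bigcapT_measurable.
- exact: (measurable_percolation_event treeT lfT peP).
rewrite (percolation_eventE treeT lfT peP) => w Uw; exists o => // n _.
have [x xn wx] := Uw n I.
have xl : lev x = n by move: xn => /=; rewrite mem_sph// => /eqP.
exists x; first by split; [exact: desc_root|rewrite xl].
split; first exact: desc_root.
by rewrite lev_root.
Qed.

End percolation_from_flow.

(** * Branching number and percolation *)

Section independence.
Variables (T : sgraph) (o : T).
Hypotheses (treeT : is_tree T) (lfT : locally_finite T).

Implicit Types u v x y z : T.

Local Notation lev v := (dist o v).
Local Notation parent := (parent o).
Local Notation desc := (desc o).

Variable pe : T -> edge T.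
Hypothesis peP : upper_edges o pe.
Variables (R : realType) (P : probability (config T) R).

Lemma walk_sym n u v : walk (@adj T) n u v -> walk (@adj T) n v u.
Proof.
case=> s [ps ls ss]; exists (rev (belast u s)).
rewrite size_rev size_belast -ls rev_path; split => //.
  by apply: sub_path ps => a b /=; rewrite adj_sym.
by case: (s) => //= a s'; rewrite rev_cons last_rcons.
Qed.

Lemma all_open_coord (F : set (edge T)) (s : seq T) :
  (forall v, v \in s -> F (pe v)) -> <<s coord_events F >> (all_open pe s).
Proof.
move=> sF; rewrite all_open_bigcap.
apply: (@fin_bigcap_measurable _ (g_sigma_algebraType (coord_events F))) => //.
move=> v vs; apply: sub_sigma_algebra; exists (pe v), true.
by split => //; exact: sF.
Qed.

(** A walk from an edge of [t] to an edge of [s] has to leave the subtree of [a], which bounds its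
    length below. *)
Lemma k_independent_subtree k : k_independent P k -> subtree_independent o pe P k.
Proof.
move=> indP a s t sP tP _ _.
apply: (indP [set pe v | v in [set` s]] [set pe v | v in [set` t]]).
- rewrite -subset0 => e [[v vs <-] [v' vt E]].
  have [vo av] := sP _ vs; have [v'o av' _] := tP _ vt.
  by case/negP: av; rewrite -(pe_inj treeT peP v'o vo E).
- apply: le_ereal_inf_tmp => _ [e [v vs <-] [f [v' vt <-] <-]].
  apply: le_ereal_inf_tmp => _ [x xe [y yf <-]].
  have [vo av] := sP _ vs; have [v'o av' lv'] := tP _ vt.
  (* For [k = 0] nothing is to be shown. Otherwise [y] may lie one level above [v'], and the last
     step out of the subtree makes up for it. *)
  rewrite lee_fin ler_nat; case: k lv' {indP tP} => // k lv'.
  have nax : ~~ desc a x.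
    move: xe; rewrite peP// => -[->|->//].
    by apply: contra av; exact: desc_child.
  have [ay ly] : desc a y /\ (lev a + k <= lev y)%N.
    move: yf; rewrite peP// => -[->|->]; last by split => //; lia.
    by rewrite lev_parent//; split; [apply: desc_parent => // aE; subst a; lia|lia].
  have := walk_leaves_subtree treeT (walk_sym (dist_spec treeT x y).1) ay nax.
  by lia.
- by apply: all_open_coord => v vs; exists v.
- by apply: all_open_coord => v vs; exists v.
Qed.

Lemma positively_associated_open : positively_associated P -> open_correlated o pe P.
Proof.
move=> paP s t _ _; apply: paP; try exact: measurable_all_open.
- exact: all_open_increasing.
- exact: all_open_increasing.
Qed.

Lemma bernoulli_all_open p s : bernoulli_percolation P p ->
  (forall v, v \in s -> v <> o) -> uniq s -> P (all_open pe s) = (p ^+ size s)%:E.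
Proof.
move=> [[_ mP] bP] sP us.
have -> : all_open pe s = \bigcap_(e in [set` map pe s]) open_at e.
  rewrite all_open_bigcap; apply/seteqP; split=> w ws e.
    by move=> /mapP[v vs ->]; exact: ws.
  by move=> es; apply: ws => /=; exact: map_f.
rewrite bP; last first.
  rewrite map_inj_in_uniq// => v v' /sP vo /sP v'o; exact: (pe_inj treeT peP).
under eq_bigr do rewrite mP.
by rewrite prodEFin big_map big_const_seq iter_mulr mulr1 count_predT.
Qed.

Lemma bernoulli_independent p s t : bernoulli_percolation P p ->
  (forall v, v \in s ++ t -> v <> o) -> uniq (s ++ t) ->
  P (all_open pe s `&` all_open pe t) = (P (all_open pe s) * P (all_open pe t))%E.
Proof.
move=> bP stP ust; rewrite -all_open_cat !(bernoulli_all_open bP)//.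
- by rewrite size_cat exprD EFinM.
- by move=> v vt; apply: stP; rewrite mem_cat vt orbT.
- by move: ust; rewrite cat_uniq => /and3P[].
- by move=> v vs; apply: stP; rewrite mem_cat vs.
- by move: ust; rewrite cat_uniq => /and3P[].
Qed.

(** Every vertex of [t] and none of [s] lies below [a], so the two sets are disjoint. *)
Lemma bernoulli_subtree p : bernoulli_percolation P p -> subtree_independent o pe P 0.
Proof.
move=> bP a s t sP tP us ut; apply: (bernoulli_independent bP).
  by move=> v; rewrite mem_cat => /orP[/sP[]|/tP[]].
rewrite cat_uniq us ut andbT; apply/hasPn => v /tP[_ av _]; apply/negP => /sP[_].
by rewrite av.
Qed.

Lemma bernoulli_open_correlated p : bernoulli_percolation P p -> open_correlated o pe P.
Proof. by move=> bP s t stP ust; rewrite (bernoulli_independent bP). Qed.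

End independence.

(** * Flows and the branching number *)

Section flow_from_percolation.
Variables (T : sgraph) (o : T).
Hypotheses (treeT : is_tree T) (lfT : locally_finite T).

Implicit Types u v x y z : T.

Local Notation lev v := (dist o v).
Local Notation parent := (parent o).
Local Notation desc := (desc o).

Variable (R : realType).

(** For a child [w] of [v], [theta w = theta v * g w / G v <= (g v / G v) * (g w / g o) <= g w / g
    o], the last step because [g v <= G v]. *)
Lemma flow_of_subflow (g : T -> R) : (forall v, 0 <= g v) -> 0 < g o ->
  (forall v, g v <= \sum_(w \in children o v) g w) ->
  exists2 theta, unit_flow o theta & forall v, theta v <= g v / g o.
Proof.
move=> g0 go gsub.
pose G v := \sum_(w \in children o v) g w.
have G0 v : 0 <= G v by exact: le_trans (gsub v).
(* The recursion runs on the level, since passing to the parent is not structural. *)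
pose th := fix th n v := if n is n'.+1 then th n' (parent v) * (g v / G (parent v)) else 1.
pose theta v := th (lev v) v.
have thetaE v : v <> o -> theta v = theta (parent v) * (g v / G (parent v)).
  by move=> vo; rewrite /theta; have [_ <-] := parentP treeT vo.
have thetao : theta o = 1 by rewrite /theta lev_root.
have theta0 v : 0 <= theta v.
  rewrite /theta; move: (lev v) => n; elim: n v => [//|n IH] v /=.
  by apply: mulr_ge0 => //; exact: divr_ge0.
have thetag v : theta v <= g v / g o.
  have [n nE] : exists n, n = lev v by exists (lev v).
  elim: n v nE => [|n IH] v nE.
    by rewrite (lev_eq0 treeT (esym nE)) thetao divff// gt_eqF.
  have vo : v <> o by move=> vo; move: nE; rewrite vo lev_root.
  have [_ lv] := parentP treeT vo.
  rewrite thetaE//; have := IH (parent v); rewrite -nE in lv; case: lv => <- /(_ erefl) h.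
  have [Gz|Gz] := eqVneq (G (parent v)) 0.
    by rewrite Gz invr0 !mulr0; apply: divr_ge0 => //; exact: ltW.
  have Gp : 0 < G (parent v) by rewrite lt_neqAle eq_sym Gz G0.
  rewrite mulrA ler_pdivrMr// (mulrC _ (g v)) -mulrA; apply: ler_wpM2l => //.
  apply: le_trans h _; rewrite mulrC; apply: ler_wpM2l; last exact: gsub.
  by rewrite invr_ge0 ltW.
exists theta => //; split => // v; split => //.
have -> : \sum_(w \in children o v) theta w = \sum_(w \in children o v) theta v / G v * g w.
  apply: eq_fsbigr => w; rewrite inE => vw.
  have [wo pw] := (children_parent o treeT v w).1 vw.
  by rewrite thetaE// pw mulrA mulrAC.
rewrite -mulr_fsumr -/(G v).
(* If [G v = 0] then [g v = 0], so no flow arrives at [v] and none has to be passed on. *)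
have [Gz|Gz] := eqVneq (G v) 0; last by rewrite divfK.
apply/eqP; rewrite Gz mulr0 eq_le theta0 andbT; apply: le_trans (thetag v) _.
by rewrite -(mul0r (g o)^-1) ler_pM2r ?invr_gt0// -Gz gsub.
Qed.

Lemma le_powR_root (b t : R) (d : nat) : 0 < b -> 0 < t -> (0 < d)%N ->
  (b <= t `^ (- (d%:R)^-1)) = (t <= b ^- d).
Proof.
move=> b0 t0 d0.
have <- : (b ^+ d <= t `^ (- d%:R^-1) ^+ d) = (b <= t `^ (- d%:R^-1)).
  by rewrite ler_pXn2r// nnegrE ?powR_ge0// ltW.
rewrite -(powR_mulrn d (powR_ge0 t _)) -powRrM mulNr mulVf ?pnatr_eq0 ?gtn_eqF//.
rewrite (powR_inv1 (ltW t0)).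
by rewrite -[in RHS](invrK t) lef_pV2 ?posrE ?invr_gt0 ?exprn_gt0.
Qed.

Lemma expr_unbounded (C x : R) : 1 < x -> exists n, forall d, (n <= d)%N -> C <= x ^+ d.
Proof.
move=> x1; have bernoulli d : 1 + d%:R * (x - 1) <= x ^+ d.
  elim: d => [|d IH]; first by rewrite mul0r addr0.
  rewrite exprS -natr1; have := ler_wpM2l (ltW (lt_trans ltr01 x1)) IH.
  have : 0 <= d%:R * (x - 1) ^+ 2 by rewrite mulr_ge0// sqr_ge0.
  lra.
have [C0|/ltW C0] := lerP 0 C; last first.
  by exists 0%N => d _; apply: le_trans C0 _; rewrite exprn_ge0// ltW// (lt_trans _ x1).
have h : 0 <= C / (x - 1) by rewrite divr_ge0// subr_ge0 ltW.
exists (Num.bound (C / (x - 1))) => d nd; apply: le_trans (bernoulli d).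
have : C / (x - 1) <= d%:R by apply: le_trans (ltW (archi_boundP h)) _; rewrite ler_nat.
by rewrite ler_pdivrMr ?subr_gt0//; lra.
Qed.

(** The constant [C] disappears in the limit: for [b < q^-1], [C <= (b * q) ^- d] for all large [d],
    and then [theta v <= b ^- d] at level [d]. *)
Lemma br_ge (theta : T -> R) (C q : R) : unit_flow o theta -> 0 < q ->
  (forall v, theta v <= C * q ^+ lev v) -> (q^-1%:E <= br R o)%E.
Proof.
move=> uth q0 thC.
have C0 : 0 < C.
  have := thC o; rewrite uth.2 lev_root// expr0 mulr1; exact: lt_le_trans.
rewrite leNgt; apply/negP => brq.
have [b [b0 brb bq]] : exists b, [/\ 0 < b, (br R o < b%:E)%E & b < q^-1].
  case: (br R o) brq => [r||]; rewrite ?lte_fin// => rq.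
    (* The midpoint lies strictly between [br] and [q^-1]; the maximum with [q^-1 / 2] keeps [b]
       positive. *)
    exists (Num.max (q^-1 / 2) ((r + q^-1) / 2)).
    have q0' : 0 < q^-1 by rewrite invr_gt0.
    by rewrite lte_fin lt_max gt_max lt_max; split; lra.
  have q0' : 0 < q^-1 by rewrite invr_gt0.
  by exists (q^-1 / 2); split; rewrite ?ltNyr//; lra.
have bq1 : 1 < (b * q)^-1.
  by rewrite invf_gt1 ?mulr_gt0// -ltr_pdivlMr// mul1r.
have [n nP] := expr_unbounded C bq1.
move: brb; apply/negP; rewrite -leNgt.
apply: le_ereal_sup_tmp; exists (liminf_dist o (flow_rate o theta)); first by exists theta.
(* [n.+1] rather than [n] excludes level 0, where the root of order [d] is meaningless. *)
apply: le_ereal_sup_tmp; eexists; first by exists n.+1.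
apply: le_ereal_inf_tmp => _ [v vn <-].
rewrite /flow_rate; case: ifPn => tv; first by rewrite leey.
rewrite lee_fin le_powR_root//.
- apply: le_trans (thC v) _.
  rewrite -ler_pdivlMr ?exprn_gt0// -invfM -exprMn -exprVn; apply: nP.
  exact: ltnW.
- by rewrite lt_neqAle eq_sym tv (uth.1 v).1.
- exact: leq_ltn_trans vn.
Qed.

Variable pe : T -> edge T.
Hypothesis peP : upper_edges o pe.
Variable P : probability (config T) R.

(** Only an upper bound on branch probabilities is asked for, so that the lemma covers Bernoulli
    percolation and also, with [q = 1], the fully open configuration. *)
Lemma br_ge_of_percolates (q : R) : 0 < q -> q <= 1 ->
  (forall m x, P (all_open pe (branch o m x)) <= (q ^+ (lev x - m))%:E)%E ->
  percolates P -> (q^-1%:E <= br R o)%E.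
Proof.
move=> q0 q1 Pq perc.
have mth u v := measurable_through o treeT lfT pe u v.
have [u uP] : exists u, P (through o pe u u) <> 0%E.
  apply: contrapT => h; move: perc; rewrite /percolates (percolation_eventE treeT lfT peP).
  rewrite (null_bigcup (P := P) o)//.
  - by rewrite ltxx.
  - exact: countable_vertices.
  - by move=> v; apply: contrapT => v0; apply: h; exists v.
pose g v := fine (P (through o pe u v)).
have g0 v : 0 <= g v by exact: fine_probability_ge0.
have go : 0 < g o.
  have : 0 < fine (P (through o pe u u)).
    rewrite lt_neqAle fine_probability_ge0 andbT eq_sym; apply/eqP => h.
    by apply: uP; rewrite -(probability_fineK P (mth u u)) h.
  move/lt_le_trans; apply; apply: fine_probability_le => // w wu n _.
  (* All vertices lie below [o], so [through u u] is contained in [through u o]. *)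
  have [x [ux nx] rx] := wu n I.
  by exists x => //; split => //; exact: desc_root.
have gsub v : g v <= \sum_(v' \in children o v) g v'.
  rewrite -lee_fin -fsumEFin; last exact: finite_children.
  rewrite probability_fineK//; under eq_fsbigr do rewrite probability_fineK//.
  apply: content_sub_fsum => //; first exact: finite_children.
  exact: through_children.
(* Below [u], the path from [u] to [v] must be open. Elsewhere the event is empty, or [v] is no
   deeper than [u] and the bound is at least 1. *)
have gq v : g v <= q ^- lev u * q ^+ lev v.
  rewrite mulrC ler_pdivlMr ?exprn_gt0// mulrC.
  have g1 : g v <= 1.
    by rewrite -lee_fin probability_fineK// probability_le1.
  have [uv|uv] := boolP (desc u v).
    rewrite -(subnKC (desc_lev uv)) exprD ler_pM2l ?exprn_gt0// -lee_fin probability_fineK//.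
    apply: le_trans (Pq _ _); apply: le_measure; rewrite ?inE//; first exact: measurable_all_open.
    move=> w wv; have [x [vx _] [ux]] := wv 0%N I.
    apply: all_open_sub => t; rewrite !mem_branch// => /andP[tv ->].
    by rewrite (desc_trans treeT tv).
  have [E|/set0P[w wv]] := eqVneq (through o pe u v) set0.
    by rewrite /g E measure0 mulr0 exprn_ge0// ltW.
  have [x [vx _] [ux _]] := wv 0%N I.
  have vu : (lev v <= lev u)%N.
    by rewrite leqNgt; apply: contra uv => /ltnW; exact: desc_comparable ux vx.
  apply: le_trans (_ : q ^+ lev u * 1 <= _).
    by rewrite ler_pM2l ?exprn_gt0.
  by rewrite mulr1; apply: ler_wiXn2l => //; exact: ltW.
have [theta uth thg] := flow_of_subflow g0 go gsub.
apply: (br_ge (C := q ^- lev u / g o)) uth q0 _ => v.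
apply: le_trans (thg v) _.
by rewrite mulrAC ler_pM2r ?invr_gt0.
Qed.

(** Some unit flow has liminf above [p^-1], hence decays at a rate [l > p^-1] from some level [n]
    on; [C = l ^+ n] takes care of the lower levels, where [theta] is at most 1. *)
Lemma percolates_of_br (p : R) : 0 < p -> p <= 1 -> (p^-1%:E < br R o)%E ->
  (exists k, subtree_independent o pe P k) -> open_correlated o pe P ->
  (forall e, P (open_at e) = p%:E) -> percolates P.
Proof.
move=> p0 p1 pbr [k indP] corP margP.
have [_ [theta uth <-]] := ereal_sup_gt pbr.
move=> /ereal_sup_gt[_ [n _ <-]] pinf.
have [l pl linf] : exists2 l, p^-1 < l &
    (l%:E <= ereal_inf [set flow_rate o theta v | v in [set v | (n <= lev v)%N]])%E.
  (* The infimum may be infinite; any real above [p^-1] then serves as [l]. *)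
  case: (ereal_inf _) pinf => [r|_|//]; last by exists (p^-1 + 1); rewrite ?leey ?ltrDl.
  by rewrite lte_fin => pr; exists r.
have l1 : 1 <= l by apply: le_trans (ltW pl); rewrite invf_ge1.
have l0 : 0 < l by exact: lt_le_trans l1.
have th0 v : 0 <= theta v by have [] := uth.1 v.
have th1 v : theta v <= 1.
  rewrite -uth.2 -(flow_sphere_root treeT lfT uth.1 (lev v)).
  rewrite (big_rem v)/=; last by rewrite mem_sph.
  by rewrite lerDl; apply: sumr_ge0.
apply: (percolates_of_flow treeT lfT peP indP corP p0 p1 margP
  (C := l ^+ n) (l := l) uth); last first.
  by rewrite -ltr_pdivrMr// div1r.
move=> v; have [nv|vn] := leqP n (lev v); last first.
  apply: le_trans (th1 v) _; rewrite ler_pdivlMr ?exprn_gt0// mul1r.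
  by apply: ler_weXn2l => //; exact: ltnW.
apply: le_trans (_ : l ^- lev v <= _); last first.
  by rewrite ler_peMl ?exprn_ege1// invr_ge0 exprn_ge0// ltW.
have [->|/eqP vo] := eqVneq v o; first by rewrite uth.2 lev_root// expr0 invr1.
have lv0 : (0 < lev v)%N by have [_ <-] := parentP treeT vo.
have [->|tv] := eqVneq (theta v) 0; first by rewrite invr_ge0 exprn_ge0// ltW.
rewrite -le_powR_root//; last by rewrite lt_neqAle eq_sym tv th0.
have : (l%:E <= flow_rate o theta v)%E.
  by apply: le_trans linf _; apply: ereal_inf_lbound; exists v.
by rewrite /flow_rate (negbTE tv) lee_fin.
Qed.

End flow_from_percolation.

(** * Bernoulli percolation *)

Section bernoulli_existence.
Variables (R : realType) (p : R).
Hypothesis p01 : 0 <= p <= 1.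

(* The [n]-th letter of the itinerary of [x] under repeatedly splitting the
   current interval in proportions [p] and [1 - p]. *)
Fixpoint bit (n : nat) (a b x : R) : bool :=
  let m := a + p * (b - a) in
  if n is n'.+1 then if x < m then bit n' a m x else bit n' m b x else x < m.

Lemma measurable_bit n a b : measurable [set x : R | bit n a b x].
Proof.
have mlt m : measurable [set x : R | x < m].
  by rewrite (_ : [set x | x < m] = `]-oo, m[%classic)// set_itvE.
elim: n a b => [|n IH] a b /=; first exact: mlt.
set m := a + p * (b - a).
rewrite (_ : [set x | _] = ([set x | x < m] `&` [set x | bit n a m x]) `|`
    (~` [set x | x < m] `&` [set x | bit n m b x])).
  by apply: measurableU; apply: measurableI => //; exact: measurableC.
apply/seteqP; split => x /=; case: ifP => xm; rewrite ?xm; [by left|by right|by case=> -[]|].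
by case=> -[].
Qed.

(** A [false] entry of [c] imposes no condition: only openness is prescribed, as in the definition
    of Bernoulli percolation. *)
Definition bits_set (c : seq bool) (a b : R) : set R :=
  [set x | forall i, nth false c i -> bit i a b x].

Lemma measurable_bits_set c a b : measurable (bits_set c a b).
Proof.
rewrite (_ : bits_set c a b =
    \bigcap_i (if nth false c i then [set x | bit i a b x] else setT)).
  by apply: bigcapT_measurable => i; case: ifP => // _; exact: measurable_bit.
apply/seteqP; split => x xc i; first by move=> _; case: ifP => // /xc.
by move=> ci; have := xc i I; rewrite ci.
Qed.

(** Splitting off the first letter, a [true] keeps only the left part, a fraction [p] of the
    interval; a [false] keeps both parts. *)
Lemma lebesgue_bits_set c a b : a <= b ->
  lebesgue_measure (`[a, b[ `&` bits_set c a b) = ((b - a) * p ^+ count id c)%:E.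
Proof.
move: p01 => /andP[p0 p1].
elim: c a b => [|h c IH] a b ab.
  rewrite (_ : bits_set _ _ _ = setT); last first.
    by apply/seteqP; split => // x _ i; rewrite nth_nil.
  rewrite setIT lebesgue_measure_itv/= lte_fin expr0 mulr1.
  by case: ltP => // ba; rewrite (_ : b = a) ?subrr//; apply/eqP; rewrite eq_le ba ab.
pose m := a + p * (b - a).
have am : a <= m by rewrite lerDl mulr_ge0// subr_ge0.
have mb : m <= b.
  by rewrite -lerBrDl ler_piMl// subr_ge0.
have itvE : `[a, b[%classic = `[a, m[%classic `|` `[m, b[%classic :> set R.
  by rewrite -itv_bndbnd_setU// bnd_simp.
have left_part : `[a, m[%classic `&` bits_set (h :: c) a b =
    `[a, m[%classic `&` bits_set c a m.
  apply/seteqP; split => x [xam xc]; split => //; move: (xam); rewrite /= in_itv/= => /andP[_ xm].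
    by move=> i ci; have := xc i.+1 ci; rewrite /= -/m xm.
  by case=> [_|i ci] /=; rewrite -/m xm//; exact: xc.
have right_part : `[m, b[%classic `&` bits_set (h :: c) a b =
    if h then set0 else `[m, b[%classic `&` bits_set c m b.
  case: ifP => hE; last first.
    apply/seteqP; split => x [xmb xc]; split => //;
      move: (xmb); rewrite /= in_itv/= leNgt => /andP[/negbTE xm _].
      by move=> i ci; have := xc i.+1 ci; rewrite /= -/m xm.
    by case=> [|i ci] /=; rewrite ?hE// -/m xm; exact: xc.
  rewrite -subset0 => x [xmb xc]; have := xc 0%N isT.
  by move: xmb; rewrite /= in_itv/= leNgt -/m => /andP[/negbTE ->].
have lebU (A B : set R) : measurable A -> measurable B -> A `&` B = set0 ->
    lebesgue_measure (A `|` B) = (lebesgue_measure A + lebesgue_measure B)%E.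
  by move=> mA mB AB; apply: (measureU lebesgue_measure mA mB AB).
rewrite itvE setIUl lebU; last 3 first.
- by apply: measurableI => //; exact: measurable_bits_set.
- by apply: measurableI => //; exact: measurable_bits_set.
- rewrite -subset0 => x [[+ _] [+ _]]; rewrite /= !in_itv/= => /andP[_ xm] /andP[mx _].
  by move: xm; rewrite ltNge mx.
rewrite left_part right_part IH// (fun_if lebesgue_measure) measure0 IH//.
case: h {left_part right_part} => /=.
  by rewrite adde0 add1n exprS /m; congr EFin; ring.
by rewrite add0n -EFinD /m; congr EFin; ring.
Qed.

Let mu : {measure set (measurableTypeR R) -> \bar R} := @lebesgue_measure R.

Let measurable_unit : measurable (`[0, 1[%classic : set (measurableTypeR R)).
Proof. exact: measurable_itv. Qed.

Definition unit_measure : set (measurableTypeR R) -> \bar R := mrestr mu measurable_unit.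

HB.instance Definition _ := Measure.on unit_measure.

Lemma unit_measure_setT : unit_measure setT = 1%E.
Proof.
rewrite /unit_measure /mrestr setTI; apply: etrans (lebesgue_measure_itv _) _.
by rewrite /= lte_fin ltr01 oppr0 adde0.
Qed.

HB.instance Definition _ := @Measure_isProbability.Build _ _ R unit_measure unit_measure_setT.

Variable T : sgraph.

(** The model is the law of the itinerary of a uniform point of [[0, 1[], with edge [e] reading
    letter [enc e]. *)
Lemma bernoulli_exists (enc : edge T -> nat) : injective enc ->
  exists P : probability (config T) R, bernoulli_percolation P p.
Proof.
move=> enc_inj.
pose f (x : measurableTypeR R) : config T := fun e => bit (enc e) 0 1 x.
have mf : measurable_fun (setT : set (measurableTypeR R)) f.
  apply: (@measurability _ _ (measurableTypeR R) (config T) setT f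
    (coord_events [set: edge T])) => //.
  move=> _ [_ [e [b [_ ->]]] <-]; rewrite setTI.
  have mb := measurable_bit (enc e) 0 1.
  case: b; first exact: mb.
  rewrite (_ : _ @^-1` _ = ~` [set x | bit (enc e) 0 1 x]); first exact: measurableC.
  by apply/seteqP; split => x /=; rewrite /f; case: bit.
pose X : {mfun measurableTypeR R >-> config T} := mfun_Sub (mem_set mf).
pose P : probability (config T) R := distribution unit_measure X.
have PE (s : seq (edge T)) : uniq s ->
    P (\bigcap_(e in [set` s]) open_at e) = (p ^+ size s)%:E.
  move=> us.
  pose N := (\max_(e <- s) enc e).+1.
  (* [c] marks the codes of the edges of [s], so its count of [true] is the size of [s]. *)
  pose c := mkseq (fun i => i \in map enc s) N.
  have sN e : e \in s -> (enc e < N)%N by move=> es; rewrite ltnS; exact: leq_bigmax_seq.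
  have cnt : count id c = size s.
    rewrite /c count_map -(size_map enc) -size_filter.
    apply/perm_size/uniq_perm; rewrite ?filter_uniq ?iota_uniq ?map_inj_uniq//.
    move=> i; rewrite mem_filter mem_iota /= add0n; case: mapP => //= -[e es ->].
    by rewrite sN.
  have preE : f @^-1` (\bigcap_(e in [set` s]) open_at e) = bits_set c 0 1.
    apply/seteqP; split => x /=.
      move=> xs i; have [iN|Ni] := ltnP i N; last by rewrite nth_default ?size_mkseq.
      by rewrite nth_mkseq// => /mapP[e es ->]; exact: xs.
    move=> xc e es; apply: xc; rewrite nth_mkseq ?sN//; exact: map_f.
  transitivity (lebesgue_measure (`[0, 1[ `&` bits_set c 0 1)); last first.
    by rewrite lebesgue_bits_set ?ler01// subr0 mul1r cnt.
  by rewrite setIC -preE.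
have P1 e : P (open_at e) = p%:E.
  have := PE [:: e] isT; rewrite expr1 => <-; congr (P _).
  apply/seteqP; split => w we; last by apply: we; rewrite /= inE.
  by move=> e'; rewrite /= inE => /eqP ->.
exists P; split; first by split.
move=> s us; rewrite PE//; under eq_bigr do rewrite P1.
by rewrite prodEFin big_const_seq iter_mulr mulr1 count_predT.
Qed.

End bernoulli_existence.

(** * The critical probability *)

Section critical_probability.
Variables (T : sgraph) (o : T).
Hypotheses (treeT : is_tree T) (lfT : locally_finite T) (infT : infinite_set [set: T]).
Variable R : realType.

(** The configuration with all edges open percolates, since the tree is infinite and connected; its
    point mass is the case [q = 1]. *)
Lemma br_ge1 : (1 <= br R o)%E.
Proof.
have [pe peP] := upper_edges_exist o treeT lfT infT.
pose w : config T := fun=> true.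
pose P : probability (config T) R := dirac w.
have wadj u v : adj u v -> open_adj w u v.
  move=> uv; apply/asboolP.
  have e_edge : [set u; v] \in @edges T by rewrite inE; exists u, v.
  by exists (@exist _ (fun A => A \in @edges T) _ e_edge).
have percP : percolates P.
  rewrite /percolates /P /= diracE mem_set ?lte_fin//; exists o.
  rewrite (_ : Defs.cluster w o = setT)//; apply/seteqP; split => // v _.
  have [n [s [ps ls ss]]] := treeT.1 o v.
  by exists n, s; split => //; apply: sub_path ps.
have := br_ge_of_percolates treeT lfT peP ltr01 (lexx 1) _ percP.
rewrite invr1; apply => m x; rewrite expr1n.
by apply: probability_le1; exact: measurable_all_open.
Qed.

Lemma lt_inv_br (p : R) : 0 < p -> (p^-1%:E < br R o)%E = ((br R o)^-1 < p%:E)%E.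
Proof.
move=> p0; have <- : (p%:E^-1 = p^-1%:E)%E by rewrite inver gt_eqF.
by rewrite inve_plt// inE ?lee_fin ?(ltW p0)//; exact: le_trans br_ge1.
Qed.

(** With [c] the inverse of [br], the non-percolating parameters all lie in [[0, c]] and include
    every [p] with [0 < p < c]. *)
Lemma pc_inv_br : ((pc R T)%:E = (br R o)^-1)%E.
Proof.
have [pe peP] := upper_edges_exist o treeT lfT infT.
have br1 := br_ge1.
have brN0 : br R o != 0%E by rewrite gt_eqF// (lt_le_trans _ br1).
have brV : ((br R o)^-1)%E \is a fin_num.
  by rewrite fin_numV// gt_eqF// (lt_le_trans _ br1)// ltNyr.
pose c := fine (br R o)^-1%E.
have cE : (c%:E = (br R o)^-1)%E by rewrite /c fineK.
have br0 : (0 <= br R o)%E by exact: le_trans br1.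
have c0 : 0 <= c by rewrite -lee_fin cE inve_ge0.
have c1 : c <= 1.
  rewrite -lee_fin cE -inve1 lee_pV2 ?inE//; exact: le_trans br1.
rewrite -cE; congr EFin; rewrite /pc; set S := [set p | _].
have Sub p : S p -> p <= c.
  move=> [P bP nperc]; rewrite leNgt; apply/negP => cp; apply: nperc.
  have p0 : 0 < p by exact: le_lt_trans cp.
  apply: (percolates_of_br treeT lfT peP p0 _ _ _ _ bP.1.2).
  - by have /andP[] := bP.1.1.
  - by rewrite lt_inv_br// -cE lte_fin.
  - by exists 0%N; exact: bernoulli_subtree bP.
  - exact: bernoulli_open_correlated bP.
have inS p : 0 < p -> p < c -> S p.
  move=> p0 ltpc.
  have p01 : 0 <= p <= 1 by rewrite !ltW// (lt_le_trans ltpc).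
  have [enc [dec encK]] := countable_enum o (countable_vertices o treeT lfT).
  have /choice[g gP] : forall e, exists v, pe v = e.
    by move=> e; have [v _ ->] := pe_surj treeT peP e; exists v.
  have [|P bP] := bernoulli_exists p01 (enc := enc \o g).
    by move=> e e' /(can_inj encK) gE; rewrite -(gP e) gE gP.
  exists P => // perc.
  have : (p^-1%:E <= br R o)%E.
    apply: (br_ge_of_percolates treeT lfT peP p0 _ _ perc); first by case/andP: p01.
    move=> m x; rewrite (bernoulli_all_open treeT peP bP) ?size_branch//.
      by move=> v; exact: branch_nonroot.
    exact: uniq_branch.
  have <- : (p%:E^-1 = p^-1%:E)%E by rewrite inver gt_eqF.
  by rewrite inve_ple ?inE ?lee_fin ?(ltW p0)// -cE lee_fin leNgt ltpc.
(* If [c = 0], then [S] is empty or [[set 0]]; both have supremum 0, the former by convention. *)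
have [c_eq0|c_neq0] := eqVneq c 0.
  have S0 p : S p -> p = 0.
    move=> Sp; apply/eqP; rewrite eq_le; have := Sub _ Sp; rewrite c_eq0 => ->.
    by case: Sp => P [[/andP[]]].
  have [->|/set0P[p Sp]] := eqVneq S set0; first by rewrite sup0 c_eq0.
  rewrite c_eq0 (_ : S = [set 0]) ?sup1//.
  by apply/seteqP; split => [q /S0//|q ->]; rewrite -(S0 _ Sp).
have cpos : 0 < c by rewrite lt_neqAle eq_sym c_neq0.
have Sc2 : S (c / 2) by apply: inS; lra.
have ubS : has_ubound S by exists c.
apply/eqP; rewrite eq_le; apply/andP; split.
  by apply: ge_sup => //; exists (c / 2).
rewrite leNgt; apply/negP => supc.
have h := ub_le_sup ubS Sc2.
(* A supremum below [c] would be exceeded by the midpoint, which is positive because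
   [c / 2 <= sup S]. *)
have mid : S ((sup S + c) / 2) by apply: inS; lra.
have := ub_le_sup ubS mid; lra.
Qed.

End critical_probability.

Theorem theorem1 (R : realType) (T : sgraph) (o : T) :
  is_tree T -> locally_finite T -> infinite_set [set: T] ->
  ((pc R T)%:E = (br R o)^-1)%E /\
  forall (P : probability (config T) R) (p : R),
    positively_associated P -> finite_range_dependent P ->
    has_marginals P p -> pc R T < p ->
    percolates P.
Proof.
move=> treeT lfT infT; have pcE := pc_inv_br o treeT lfT infT R.
split=> // P p paP [k indP] [/andP[p0 p1] margP] pcp.
have [pe peP] := upper_edges_exist o treeT lfT infT.
have p_pos : 0 < p.
  apply: le_lt_trans pcp; rewrite -lee_fin pcE inve_ge0.
  by apply: le_trans (br_ge1 o treeT lfT infT R).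
apply: (percolates_of_br treeT lfT peP p_pos p1 _ _ _ margP).
- by rewrite lt_inv_br// -pcE lte_fin.
- by exists k; exact: k_independent_subtree.
- exact: positively_associated_open.
Qed.
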